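(* (1) The category $\mathbf{PAb}_{\mathrm{nA}}$ of non-Archimedean Polish abelian groups has enough injective objects and enough projective objects, and homological dimension $1$. (2) The category $\mathbf{proLiePAb}_{\mathbb{Z}}$ of type $\mathbb{Z}$ pro-Lie Polish abelian groups has enough projective objects but not enough injective objects, and homological dimension $1$. An object in $\mathbf{proLiePAb}_{\mathbb{Z}}$ has an injective resolution if and only if it is injective.
   Context: A Polish abelian group is an abelian topological group whose topology is Polish. It is non-Archimedean if it has a basis of zero neighborhoods consisting of subgroups. An abelian Polish Lie group is a Polish abelian group isomorphic to $\mathbb{R}^{n}\oplus \mathbb{T}^{d}\oplus D$ with $n,d\in\omega$ and $D$ countable discrete. For a Polish abelian group $G$, $\mathcal{N}(G)$ is the set of closed subgroups $N$ with $G/N$ a Lie group; $G$ is pro-Lie if every neighborhood of $0$ contains an element of $\mathcal{N}(G)$. A pro-Lie Polish abelian group $G$ has type $\mathbb{Z}$ if every element of $\mathcal{N}(G)$ contains some $N\in\mathcal{N}(G)$ such that $G/N$ is discrete and torsion-free. Morphisms in both categories are the continuous homomorphisms. The category $\mathbf{proLiePAb}_{\mathbb{Z}}$ is a fully exact (i.e., full and closed under extensions) subcategory of the category of pro-Lie Polish abelian groups. In both categories short exact sequences are the sequences $0\to A\to B\to C\to 0$ of continuous homomorphisms, with all three terms in the category, that are algebraically exact with $A\to B$ a homeomorphism onto a closed subgroup; an admissible monic (epic) is a morphism that appears as the first (second) map of such a sequence. Thus in $\mathbf{proLiePAb}_{\mathbb{Z}}$ an admissible monic is a closed embedding whose quotient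 is also of type $\mathbb{Z}$. An object $I$ is injective if $\mathrm{Hom}(-,I)$ maps short exact sequences to short exact sequences of abelian groups, and $P$ is projective if $\mathrm{Hom}(P,-)$ does. There are enough injectives (projectives) if for every object $A$ there is an admissible monic $A\to I$ with $I$ injective (admissible epic $P\to A$ with $P$ projective). An injective resolution of $A$ is a complex $I^{0}\to I^{1}\to\cdots$ of injective objects with a map $A\to I^{0}$ such that $0\to A\to I^{0}\to I^{1}\to\cdots$ is acyclic, i.e. it is obtained by splicing short exact sequences of the category. For an exact category $\mathcal{A}$, $\mathrm{Ext}^{n}(A,B):=\mathrm{Hom}_{\mathrm{D}(\mathcal{A})}(A,B[n])$ with $\mathrm{D}(\mathcal{A})$ the derived category (equivalently, Yoneda $n$-extensions for $n\ge 1$), and the homological dimension is the least $d$ such that $\mathrm{Ext}^{n}=0$ for all $n>d$. *)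

(* Defs.v *)
From HB Require Import structures.
From mathcomp Require Import all_boot all_order all_algebra ring_quotient.
From mathcomp Require Import all_classical all_reals all_analysis.

Set Implicit Arguments.
Unset Strict Implicit.
Unset Printing Implicit Defensive.

Import Order.TTheory GRing.Theory Num.Theory.
Import numFieldNormedType.Exports.

Local Open Scope classical_set_scope.
Local Open Scope ring_scope.
Local Open Scope quotient_scope.

(* The quotient group [G / N] with the quotient topology. *)
Definition tquot (G : topologicalZmodType) (N : zmodClosed G) : Type :=
  Quotient.quot N.

Section TopologicalQuotient.
Variables (G : topologicalZmodType) (N : zmodClosed G).

HB.instance Definition _ := Choice.on (tquot N).
HB.instance Definition _ := EqQuotient.on (tquot N).
HB.instance Definition _ := GRing.Zmodule.on (tquot N).
HB.instance Definition _ := ZmodQuotient.on (tquot N).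

Let topen (U : set (tquot N)) := open (\pi_(tquot N) @^-1` U).

Let topenT : topen setT.
Proof. by rewrite /topen preimage_setT; exact: openT. Qed.

Let topenI : setI_closed topen.
Proof. by move=> U V oU oV; rewrite /topen preimage_setI; exact: openI. Qed.

Let topen_bigU (I : Type) (f : I -> set (tquot N)) :
  (forall i, topen (f i)) -> topen (\bigcup_i f i).
Proof.
by move=> of_; rewrite /topen preimage_bigcup; apply: bigcup_open => i _; exact: of_.
Qed.

HB.instance Definition _ :=
  isOpenTopological.Build (tquot N) topenT topenI topen_bigU.

Let pi_sub (x y : G) : \pi_(tquot N) (x - y) = \pi_(tquot N) x - \pi_(tquot N) y.
Proof. exact: raddfB. Qed.

Let pi_open (U : set G) : open U -> open (\pi_(tquot N) @` U).
Proof.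
move=> oU; rewrite /open/= /topen.
rewrite (_ : _ @^-1` _ =
  \bigcup_(n in [set` N]) ((fun x => x + n) @^-1` U)).
  apply: bigcup_open => n _; apply: open_comp oU => x _.
  apply: (@continuous_comp _ _ _ (fun x => (x, n)) (fun z : G * G => z.1 + z.2)).
    by apply: cvg_pair => /=; [exact: cvg_id|exact: cvg_cst].
  exact: add_continuous.
apply/seteqP; split=> [x [y Uy] /eqP|x [n /= Nn Uxn]].
  rewrite -Quotient.idealrBE => yx; exists (y - x) => //=.
  by rewrite addrC subrK.
exists (x + n) => //; apply/eqP; rewrite -Quotient.idealrBE.
by rewrite addrAC subrr add0r.
Qed.

Lemma tquot_sub_continuous :
  continuous (fun z : tquot N * tquot N => z.1 - z.2).
Proof.
move=> [a b] /= W; rewrite -[a]reprK -[b]reprK -pi_sub => W_.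
have /(@sub_continuous G (repr a, repr b)) [[U V] /= [Ua Vb] UVW] :
  nbhs (repr a - repr b) (\pi_(tquot N) @^-1` W).
  move: W_; rewrite nbhsE /= => -[W' [oW' W'ab] W'W].
  by rewrite nbhsE; exists (\pi_(tquot N) @^-1` W') => // x /W'W.
have [U' [oU' U'a] U'U] : exists2 U', open_nbhs (repr a) U' & U' `<=` U.
  by rewrite nbhsE in Ua.
have [V' [oV' V'b] V'V] : exists2 V', open_nbhs (repr b) V' & V' `<=` V.
  by rewrite nbhsE in Vb.
exists (\pi_(tquot N) @` U', \pi_(tquot N) @` V') => /=.
  split; apply: open_nbhs_nbhs; split; try exact: pi_open.
    by exists (repr a).
  by exists (repr b).
move=> [_ _] /= [[x U'x <-] [y V'y <-]]; rewrite -pi_sub.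
by apply: (UVW (x, y)); split; [exact: U'U|exact: V'V].
Qed.

HB.instance Definition _ :=
  PreTopologicalNmodule_isTopologicalZmodule.Build (tquot N) tquot_sub_continuous.
End TopologicalQuotient.

Definition discrete (T : topologicalType) : Prop := forall x : T, open [set x].

Definition torsion_free (G : zmodType) : Prop :=
  forall (x : G) (n : nat), (0 < n)%N -> x *+ n = 0 -> x = 0.

(* [R] only serves as the real line in which distances take their values. *)
Definition polish (R : realType) (T : topologicalType) : Prop :=
  (exists2 S : set T, countable S & dense S) /\
  (exists (M : metricType R) (f : T -> M) (g : M -> T),
    [/\ cancel f g, cancel g f, continuous f, continuous g
      & forall F : set_system M, ProperFilter F -> cauchy F ->
          exists x : M, F --> x]).

Definition non_archimedean (G : topologicalZmodType) : Prop :=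
  forall U : set G, nbhs 0 U ->
    exists2 H : zmodClosed G, nbhs 0 [set` H] & [set` H] `<=` U.

(* [Num.int_num_subdef] is the Boolean predicate underlying [Num.int]. *)
Definition integers (R : realType) : zmodClosed R :=
  Algebra.ZmodClosed.clone R (@Num.int_num_subdef R) _.

Definition torus (R : realType) : topologicalZmodType := @tquot R (integers R).

Definition abelian_polish_lie (R : realType) (G : topologicalZmodType) : Prop :=
  polish R G /\
  exists (n d : nat) (D : topologicalZmodType),
    [/\ discrete D, countable [set: D]
      & exists (f : G -> 'rV[R]_n * 'rV[torus R]_d * D)
               (g : 'rV[R]_n * 'rV[torus R]_d * D -> G),
          [/\ zmod_morphism f, cancel f g, cancel g f, continuous f
            & continuous g]].

(* [N] belongs to the family N(G) of the closed subgroups with Lie quotient. *)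
Definition lie_kernel (R : realType) (G : topologicalZmodType)
    (N : zmodClosed G) : Prop :=
  closed [set` N] /\ abelian_polish_lie R (tquot N).

Definition pro_lie (R : realType) (G : topologicalZmodType) : Prop :=
  forall U : set G, nbhs 0 U ->
    exists2 N : zmodClosed G, lie_kernel R N & [set` N] `<=` U.

Definition type_Z (R : realType) (G : topologicalZmodType) : Prop :=
  forall N : zmodClosed G, lie_kernel R N ->
    exists N' : zmodClosed G,
      [/\ lie_kernel R N', [set` N'] `<=` [set` N], discrete (tquot N')
        & torsion_free (tquot N')].

Definition PAb_nA (R : realType) (G : topologicalZmodType) : Prop :=
  polish R G /\ non_archimedean G.

Definition proLiePAb_Z (R : realType) (G : topologicalZmodType) : Prop :=
  [/\ polish R G, pro_lie R G & type_Z R G].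

Record chom (G H : topologicalZmodType) := CHom {
  chom_fun :> {additive G -> H};
  chom_continuous : continuous chom_fun }.

Lemma idfun_continuous (G : topologicalZmodType) :
  continuous (idfun : {additive G -> G}).
Proof. by move=> x. Qed.

Definition chom_id (G : topologicalZmodType) : chom G G :=
  CHom (@idfun_continuous G).

Definition closed_embedding (A B : topologicalZmodType) (i : chom A B) : Prop :=
  closed (range i) /\
  exists2 g : B -> A, cancel i g & {within range i, continuous g}.

Definition short_exact (A B C : topologicalZmodType) (i : chom A B)
    (p : chom B C) : Prop :=
  [/\ closed_embedding i, range i = p @^-1` [set 0] & range p = setT].

(* A class of topological abelian groups [K] is viewed as a full subcategory,
   whose short exact sequences are those with all three terms in [K]. *)
Record obj (K : topologicalZmodType -> Prop) := Obj {
  obj_sort :> topologicalZmodType;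
  objP : K obj_sort }.

Section ExactCategory.
Variable K : topologicalZmodType -> Prop.
Implicit Types (A B C I P : obj K).

Definition admissible_monic A B (i : chom A B) : Prop :=
  exists C (p : chom B C), short_exact i p.

Definition admissible_epic B C (p : chom B C) : Prop :=
  exists A (i : chom A B), short_exact i p.

(* For every short exact sequence A -> B -> C, the sequence of abelian groups
   0 -> Hom(C, I) -> Hom(B, I) -> Hom(A, I) -> 0 is exact. *)
Definition injective_obj I : Prop :=
  forall A B C (i : chom A B) (p : chom B C), short_exact i p ->
  [/\ forall h : chom C I, (forall x, h (p x) = 0) -> forall x, h x = 0,
      forall h : chom B I, (forall x, h (i x) = 0) <->
        exists k : chom C I, forall x, h x = k (p x)
    & forall h : chom A I, exists k : chom B I, forall x, k (i x) = h x].

(* Dually, 0 -> Hom(P, A) -> Hom(P, B) -> Hom(P, C) -> 0 is exact. *)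
Definition projective_obj P : Prop :=
  forall A B C (i : chom A B) (p : chom B C), short_exact i p ->
  [/\ forall h : chom P A, (forall x, i (h x) = 0) -> forall x, h x = 0,
      forall h : chom P B, (forall x, p (h x) = 0) <->
        exists k : chom P A, forall x, h x = i (k x)
    & forall h : chom P C, exists k : chom P B, forall x, p (k x) = h x].

Definition enough_injectives : Prop :=
  forall A, exists I (i : chom A I), injective_obj I /\ admissible_monic i.

Definition enough_projectives : Prop :=
  forall A, exists P (p : chom P A), projective_obj P /\ admissible_epic p.

(* The sequence 0 -> A -> I 0 -> I 1 -> ... is spliced from the short exact
   sequences A -> I 0 -> Z 0 and Z n -> I n.+1 -> Z n.+1. *)
Definition has_injective_resolution A : Prop :=
  exists (I : nat -> obj K) (eta : chom A (I 0%N))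
         (d : forall n, chom (I n) (I n.+1)),
    (forall n, injective_obj (I n)) /\
    exists (Z : nat -> obj K) (p : forall n, chom (I n) (Z n))
           (j : forall n, chom (Z n) (I n.+1)),
      [/\ short_exact eta (p 0%N),
          forall n, short_exact (j n) (p n.+1)
        & forall n x, d n x = j n (p n x)].

Record extension A B := Extension {
  ext_mid : obj K;
  ext_in : chom B ext_mid;
  ext_out : chom ext_mid A;
  ext_exact : short_exact ext_in ext_out }.

(* [yoneda m A B] is the type of Yoneda (m+1)-extensions of A by B, i.e. of
   acyclic sequences 0 -> B -> E_0 -> ... -> E_m -> A -> 0, each given as the
   splicing of B -> E_0 -> Z with an m-extension of A by Z. *)
Fixpoint yoneda (m : nat) A B : Type :=
  if m is m'.+1 then {Z : obj K & (extension Z B * yoneda m' A Z)%type}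
  else extension A B.

(* There is a morphism of exact sequences which is b on the left end and the
   identity on the right end A. *)
Fixpoint yoneda_map (m : nat) A B B' (b : chom B B') :
    yoneda m A B -> yoneda m A B' -> Prop :=
  if m is m'.+1 then fun E E' =>
    let e := (projT2 E).1 in let e' := (projT2 E').1 in
    exists (f : chom (ext_mid e) (ext_mid e')) (z : chom (projT1 E) (projT1 E')),
      [/\ forall x, f (ext_in e x) = ext_in e' (b x),
          forall x, ext_out e' (f x) = z (ext_out e x)
        & yoneda_map z (projT2 E).2 (projT2 E').2]
  else fun e e' =>
    exists f : chom (ext_mid e) (ext_mid e'),
      (forall x, f (ext_in e x) = ext_in e' (b x)) /\
      (forall x, ext_out e' (f x) = ext_out e x).

Inductive yoneda_equiv (m : nat) A B : yoneda m A B -> yoneda m A B -> Prop :=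
| yoneda_equiv_map E E' : yoneda_map (chom_id B) E E' -> yoneda_equiv E E'
| yoneda_equiv_refl E : yoneda_equiv E E
| yoneda_equiv_sym E E' : yoneda_equiv E E' -> yoneda_equiv E' E
| yoneda_equiv_trans E E' E'' :
    yoneda_equiv E E' -> yoneda_equiv E' E'' -> yoneda_equiv E E''.

(* Ext^(m+1)(A, B) = 0. The group Ext^(m+1)(A, B) is the set of Yoneda
   (m+1)-extensions modulo equivalence; it vanishes when it has a single
   element, the class of the trivial extension. *)
Definition Ext_succ_vanishes (m : nat) A B : Prop :=
  forall E E' : yoneda m A B, yoneda_equiv E E'.

Definition Ext_vanishes_above (d : nat) : Prop :=
  forall m : nat, (d < m.+1)%N -> forall A B, Ext_succ_vanishes m A B.

Definition homological_dimension (d : nat) : Prop :=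
  Ext_vanishes_above d /\
  forall d' : nat, Ext_vanishes_above d' -> (d <= d')%N.

End ExactCategory.

(* Main.v *)
(* A Polish non-Archimedean abelian group is the same thing as a group with a
   decreasing sequence of subgroups of countable index that is separated and
   complete; it is of type Z if and only if these subgroups can be chosen pure,
   because a one-parameter subgroup of a non-Archimedean group is trivial, so
   that Lie quotients are discrete.

   Countable products of countable free groups are projective, by successive
   approximation and the open mapping theorem, and surject onto every object.
   Dually, a complete filtration by divisible subgroups makes a group injective.
   If N is the kernel of a surjection of a product of free groups P onto G, and
   V is P tensored with Q in each factor, then G = P/N embeds into V/N, which is
   injective, and quotients of such groups are again injective. As over a
   hereditary ring, it follows that closed subgroups of P are projective: every
   object has a projective resolution of length 1, and Ext^2 vanishes.

   The sequence Z[X] -> Z[X] -> Z[1/n] given by multiplication by 1 - nX does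
   not split, so Ext^1 is not zero. By a diagonal argument, an injective object
   of type Z is n-divisible, for it has countable quotients by pure open
   subgroups. Conversely divisible objects of type Z are injective, and
   divisibility passes to the kernel of a morphism onto a torsion-free group.
   Hence an object with an injective resolution is injective, and Z[X] does not
   embed into an injective object. *)
From HB Require Import structures.
Require Import Defs.
From mathcomp Require Import all_boot all_order all_algebra ring_quotient.
From mathcomp Require Import all_classical all_reals all_analysis ring zify.

Set Implicit Arguments.
Unset Strict Implicit.
Unset Printing Implicit Defensive.

Import Order.TTheory GRing.Theory Num.Theory.
Import numFieldNormedType.Exports.

Local Open Scope classical_set_scope.
Local Open Scope ring_scope.
Local Open Scope quotient_scope.

(** * Abelian groups and subgroups *)

(* [zmod] decides equations between sums and differences in abelian groups by
   comparing integer coefficients ([ring] does not handle plain Z-modules). *)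
Inductive zexpr := ZVar of nat | ZZero | ZAdd of zexpr & zexpr | ZOpp of zexpr.

Fixpoint zeval (G : zmodType) (env : seq G) (e : zexpr) : G :=
  match e with
  | ZVar n => nth 0 env n
  | ZZero => 0
  | ZAdd e1 e2 => zeval env e1 + zeval env e2
  | ZOpp e1 => - zeval env e1
  end.

Fixpoint zcoef (e : zexpr) (i : nat) : int :=
  match e with
  | ZVar n => (n == i)%:Z
  | ZZero => 0
  | ZAdd e1 e2 => zcoef e1 i + zcoef e2 i
  | ZOpp e1 => - zcoef e1 i
  end.

Lemma zevalE (G : zmodType) (env : seq G) (e : zexpr) :
  zeval env e = \sum_(i < size env) nth 0 env i *~ zcoef e i.
Proof.
elim: e => [n||e1 IH1 e2 IH2|e1 IH1] /=.
- case: (ltnP n (size env)) => nenv; last first.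
    rewrite nth_default// big1// => i _.
    by rewrite gtn_eqF ?mulr0z// (leq_trans _ nenv).
  rewrite (bigD1 (Ordinal nenv))//= eqxx mulr1z big1 ?addr0// => i ni.
  by rewrite -[n]/(val (Ordinal nenv)) val_eqE eq_sym (negPf ni) mulr0z.
- by rewrite big1// => i _; rewrite mulr0z.
- by rewrite IH1 IH2 -big_split; apply: eq_bigr => i _; rewrite mulrzDr.
- by rewrite IH1 -sumrN; apply: eq_bigr => i _; rewrite mulrNz.
Qed.

Lemma zeval_eq (G : zmodType) (env : seq G) (e1 e2 : zexpr) :
  all (fun i => zcoef e1 i == zcoef e2 i) (iota 0 (size env)) ->
  zeval env e1 = zeval env e2.
Proof.
move=> /allP ee; rewrite !zevalE; apply: eq_bigr => i _.
have /ee/eqP -> // : val i \in iota 0 (size env) by rewrite mem_iota /=.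
Qed.

Ltac zindex x env :=
  lazymatch env with
  | x :: _ => constr:(O)
  | _ :: ?r => let n := zindex x r in constr:(S n)
  end.

Ltac zinsert x env :=
  lazymatch env with
  | context [x :: _] => env
  | _ => constr:(x :: env)
  end.

Ltac zvars t env :=
  lazymatch t with
  | (?a + ?b)%R => let e := zvars a env in zvars b e
  | (- ?a)%R => zvars a env
  | 0%R => env
  | ?x => zinsert x env
  end.

Ltac zquote t env :=
  lazymatch t with
  | (?a + ?b)%R =>
    let a' := zquote a env in let b' := zquote b env in constr:(ZAdd a' b')
  | (- ?a)%R => let a' := zquote a env in constr:(ZOpp a')
  | 0%R => constr:(ZZero)
  | ?x => let n := zindex x env in constr:(ZVar n)
  end.

Ltac zmod :=
  rewrite /=;
  lazymatch goal with
  | |- @eq ?T ?a ?b =>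
    let env := zvars a (@nil T) in let env := zvars b env in
    let ea := zquote a env in let eb := zquote b env in
    refine (@zeval_eq _ env ea eb _); reflexivity
  end.

(** Runs the successive approximations and Baire constructions below: [Q] is the invariant at each
    stage, [S] relates consecutive stages. *)
Lemma dependent_choice_from (T : Type) (Q : nat -> T -> Prop)
    (S : nat -> T -> T -> Prop) (x0 : T) :
    Q 0%N x0 -> (forall n x, Q n x -> exists2 y, Q n.+1 y & S n x y) ->
  exists u : nat -> T, [/\ u 0%N = x0, forall n, Q n (u n)
    & forall n, S n (u n) (u n.+1)].
Proof.
move=> Q0 QS.
have next n (x : {x | Q n x}) : {y : {y | Q n.+1 y} | S n (sval x) (sval y)}.
  by case: x => x Qx; case: (cid2 (QS n x Qx)) => y Qy Sxy; exists (exist _ y Qy).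
pose u := fix u n : {x | Q n x} :=
  if n is m.+1 then sval (next m (u m)) else exist _ x0 Q0.
exists (fun n => sval (u n)); split=> // n; first exact: (svalP (u n)).
exact: (svalP (next n (u n))).
Qed.

Definition subgroup (G : zmodType) (A : set G) : Prop :=
  A 0 /\ forall x y, A x -> A y -> A (x - y).

Section Subgroup.
Variables (G : zmodType) (A : set G).
Hypothesis sA : subgroup A.

Lemma subgroup0 : A 0. Proof. exact: sA.1. Qed.

Lemma subgroupB x y : A x -> A y -> A (x - y). Proof. exact: sA.2. Qed.

Lemma subgroupN x : A x -> A (- x).
Proof. by move=> Ax; rewrite -sub0r; exact: subgroupB subgroup0 Ax. Qed.

Lemma subgroupD x y : A x -> A y -> A (x + y).
Proof. by move=> Ax Ay; rewrite -[y]opprK; apply/subgroupB/subgroupN. Qed.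

Lemma subgroup_subC x y : A (x - y) -> A (y - x).
Proof. by move=> /subgroupN; rewrite opprB. Qed.

Lemma subgroup_trans y x z : A (x - y) -> A (y - z) -> A (x - z).
Proof. by move=> xy /(subgroupD xy); rewrite addrA subrK. Qed.

Lemma subgroup_sum (I : Type) (r : seq I) (P : pred I) (F : I -> G) :
  (forall i, P i -> A (F i)) -> A (\sum_(i <- r | P i) F i).
Proof. by move=> AF; elim/big_ind: _ => //; [exact: subgroup0|exact: subgroupD]. Qed.

Lemma subgroupMn x n : A x -> A (x *+ n).
Proof.
by move=> Ax; elim: n => [|n IH]; [exact: subgroup0|rewrite mulrS; exact: subgroupD].
Qed.

Lemma subgroupMz x (k : int) : A x -> A (x *~ k).
Proof.
move=> Ax; case: k => n; first exact: (subgroupMn n Ax).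
by rewrite NegzE mulrNz; apply: subgroupN; exact: (subgroupMn n.+1 Ax).
Qed.
End Subgroup.

(** A Boolean form, by classical decidability, from which [zmodClosed] and hence [tquot] can be
    formed. The proof argument lets the closure instance be inferred. *)
Definition subgroup_pred (G : zmodType) (A : set G) of subgroup A : G -> bool :=
  fun x => `[< A x >].

Section SubgroupPred.
Variables (G : zmodType) (A : set G) (sA : subgroup A).

Let subgroup_pred_closed : zmod_closed (subgroup_pred sA).
Proof.
split=> [|x y]; first by apply/asboolP; exact: subgroup0.
by move=> /asboolP Ax /asboolP Ay; apply/asboolP; exact: subgroupB.
Qed.

HB.instance Definition _ :=
  GRing.isZmodClosed.Build G (subgroup_pred sA) subgroup_pred_closed.

Definition zmod_of_subgroup : zmodClosed G :=
  Algebra.ZmodClosed.clone G (subgroup_pred sA) _.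

Lemma in_zmod_of_subgroup x : (x \in zmod_of_subgroup) <-> A x.
Proof. by split=> /asboolP. Qed.

Lemma set_zmod_of_subgroup : [set` zmod_of_subgroup] = A.
Proof. by apply/seteqP; split=> x /in_zmod_of_subgroup. Qed.
End SubgroupPred.

Lemma zmodClosed_subgroup (G : zmodType) (N : zmodClosed G) :
  subgroup [set` N].
Proof. by split=> /= [|x y]; [exact: rpred0|exact: rpredB]. Qed.

Lemma subgroup_preim (G H : zmodType) (f : {additive G -> H}) (A : set H) :
  subgroup A -> subgroup (f @^-1` A).
Proof.
move=> sA; split=> [|x y] /=; first by rewrite raddf0; exact: subgroup0.
by rewrite raddfB; exact: subgroupB.
Qed.

Lemma subgroup_image (G H : zmodType) (f : {additive G -> H}) (A : set G) :
  subgroup A -> subgroup (f @` A).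
Proof.
move=> sA; split=> [|_ _ [x Ax <-] [y Ay <-]].
  by exists 0; [exact: subgroup0|exact: raddf0].
by exists (x - y); [exact: subgroupB|rewrite raddfB].
Qed.

Lemma subgroupI (G : zmodType) (A B : set G) :
  subgroup A -> subgroup B -> subgroup (A `&` B).
Proof.
move=> sA sB; split=> [|x y [Ax Bx] [Ay By]].
  by split; exact: subgroup0.
by split; exact: subgroupB.
Qed.

(* [cf_complete] is completeness for the group uniformity, stated without
   any topology. *)
Record complete_filtration (G : zmodType) (H : nat -> set G) : Prop := {
  cf_sub : forall n, subgroup (H n);
  cf_T : H 0%N = setT;
  cf_S : forall n, H n.+1 `<=` H n;
  cf_sep : forall x, (forall n, H n x) -> x = 0;
  cf_complete : forall x : nat -> G, (forall n, H n (x n.+1 - x n)) ->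
    exists l, forall n, H n (l - x n);
  cf_countable : forall n, exists g : nat -> G, forall x, exists k, H n (x - g k)
}.

Definition base0 (G : topologicalZmodType) (H : nat -> set G) : Prop :=
  (forall n, nbhs 0 (H n)) /\
  (forall U : set G, nbhs 0 U -> exists n, H n `<=` U).

Definition na_filtration (G : topologicalZmodType) (H : nat -> set G) : Prop :=
  complete_filtration H /\ base0 H.

Lemma cf_le (G : zmodType) (H : nat -> set G) :
  complete_filtration H -> forall m n, (m <= n)%N -> H n `<=` H m.
Proof.
move=> cH m n /subnK <-; elim: (n - m)%N => [|k IH] //.
by rewrite addSn => x /(cf_S cH)/IH.
Qed.

Section Topology.
Variable G : topologicalZmodType.

Lemma translate_continuous (a : G) : continuous (fun x => a + x).
Proof.
move=> x; apply: (@continuous_comp _ _ _ (fun x => (a, x)) (fun z : G * G => z.1 + z.2)).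
  by apply: cvg_pair => /=; [exact: cvg_cst|exact: cvg_id].
exact: add_continuous.
Qed.

Lemma nbhs_translate (x : G) (U : set G) :
  nbhs x U <-> nbhs 0 ((fun h => x + h) @^-1` U).
Proof.
split=> [Ux|U0].
  have := @translate_continuous x 0; rewrite /continuous_at addr0.
  by move=> /(_ _ Ux).
have := @translate_continuous (- x) x; rewrite /continuous_at addNr.
move=> /(_ _ U0) Ux; apply: (@filterS _ _ (nbhs_filter x) _ _ _ Ux) => y /=.
by rewrite addrA subrr add0r.
Qed.

Lemma subgroup_open (A : set G) : subgroup A -> nbhs 0 A -> open A.
Proof.
move=> sA A0; rewrite openE => x Ax; apply/nbhs_translate.
by apply: filterS A0 => h Ah /=; exact: subgroupD.
Qed.

Variable H : nat -> set G.
Hypothesis bH : base0 H.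

Lemma base0_nbhsP (x : G) (U : set G) :
  nbhs x U <-> exists n, forall y, H n (y - x) -> U y.
Proof.
split=> [/nbhs_translate/(bH.2) [n HU]|[n HU]].
  by exists n => y /HU /=; rewrite addrC subrK.
apply/nbhs_translate; apply: filterS (bH.1 n) => h Hh; apply: HU.
by rewrite addrC addKr.
Qed.

Lemma base0_closedP (A : set G) : (forall n, subgroup (H n)) ->
  closed A <-> forall x, (forall n, exists2 a, A a & H n (x - a)) -> A x.
Proof.
move=> sH; split=> [cA x xA|cA x clx].
  apply: cA => U /base0_nbhsP [n HU]; have [a Aa xa] := xA n.
  by exists a; split=> //; apply: HU; exact: subgroup_subC.
apply: cA => n; have [|a [Aa ax]] := clx ((fun y => H n (y - x))).
  by apply/base0_nbhsP; exists n.
by exists a => //; exact: subgroup_subC.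
Qed.
End Topology.

Lemma base0_continuousP (A B : topologicalZmodType) (HA : nat -> set A)
    (HB : nat -> set B) (f : {additive A -> B}) : base0 HA -> base0 HB ->
  continuous f <-> forall n, exists m, forall x, HA m x -> HB n (f x).
Proof.
move=> bA bB; split=> [cf n|cf x].
  have /cf : nbhs (f 0) (HB n) by rewrite raddf0; exact: bB.1.
  by move=> /(bA.2) [m Hm]; exists m => x /Hm.
move=> U /(base0_nbhsP bB) [n HU]; have [m Hm] := cf n.
apply/(base0_nbhsP bA); exists m => y /Hm yx; apply: HU.
by rewrite -raddfB.
Qed.

(** * Polish non-Archimedean groups as filtered groups *)

Section FiltrationNorm.
Variables (R : realType) (G : zmodType) (H : nat -> set G).
Hypothesis cH : complete_filtration H.

Let level_ex (x : G) : x <> 0 -> exists n, ~~ `[< H n x >].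
Proof.
move=> x0; apply: contrapT => /forallNP Hx; apply: x0; apply: (cf_sep cH) => n.
by have /negP := Hx n; rewrite negbK => /asboolP.
Qed.

(** With m the first level that misses x, the value 1/(m+1) makes the ball of radius 1/(n+1) equal
    to the coset of [H n]. *)
Definition filtration_norm (x : G) : R :=
  if pselect (x = 0) is right x0 then (ex_minn (level_ex x0)).+1%:R^-1 else 0.

Lemma filtration_norm0 : filtration_norm 0 = 0.
Proof. by rewrite /filtration_norm; case: pselect. Qed.

Lemma filtration_norm_ge0 x : 0 <= filtration_norm x.
Proof. by rewrite /filtration_norm; case: pselect. Qed.

Lemma filtration_norm_eq0 x : filtration_norm x = 0 -> x = 0.
Proof.
rewrite /filtration_norm; case: pselect => // x0 /eqP.
by rewrite invr_eq0 pnatr_eq0.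
Qed.

Lemma filtration_norm_lt n x : (filtration_norm x < n.+1%:R^-1) = `[< H n x >].
Proof.
rewrite /filtration_norm; case: pselect => [->|x0].
  by rewrite invr_gt0 ltr0n; apply/esym/asboolP; exact: subgroup0 (cf_sub cH n).
rewrite ltf_pV2 ?posrE ?ltr0n// ltr_nat ltnS.
case: ex_minnP => m /asboolP Hm minm; apply/idP/idP => [nm|/asboolP Hn].
  by apply: contraLR nm => /minm; rewrite -leqNgt.
by rewrite ltnNge; apply/negP => mn; apply: Hm; exact: (cf_le cH mn).
Qed.

Lemma filtration_norm_le x y :
  (forall n, H n x -> H n y) -> filtration_norm y <= filtration_norm x.
Proof.
move=> xy; rewrite leNgt {2}/filtration_norm; case: pselect => [_|y0].
  by rewrite -leNgt filtration_norm_ge0.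
case: ex_minnP => m /asboolP Hm minm; rewrite filtration_norm_lt.
by apply/asboolP => /xy.
Qed.

Lemma filtration_normN x : filtration_norm (- x) = filtration_norm x.
Proof.
apply/eqP; rewrite eq_le; apply/andP; split; apply: filtration_norm_le => n Hx.
  exact: subgroupN (cf_sub cH n) _ Hx.
by rewrite -[x]opprK; exact: subgroupN (cf_sub cH n) _ Hx.
Qed.

Lemma filtration_normD x y :
  filtration_norm (x + y) <= filtration_norm x + filtration_norm y.
Proof.
rewrite {1}/filtration_norm; case: pselect => [_|xy0].
  by rewrite addr_ge0 ?filtration_norm_ge0.
case: ex_minnP => m /asboolP Hm _; rewrite leNgt; apply/negP => xy.
apply: Hm; apply: (subgroupD (cf_sub cH m)); apply/asboolP;
  rewrite -filtration_norm_lt; apply: le_lt_trans xy.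
  by rewrite lerDl filtration_norm_ge0.
by rewrite lerDr filtration_norm_ge0.
Qed.

(* The dummy arguments let the metric structure be inferred from the type. *)
Definition filtration_metric (_ : realType) (_ : complete_filtration H) : Type := G.

Local Notation M := (filtration_metric R cH).

HB.instance Definition _ := GRing.Zmodule.on M.

Let dist (x y : M) : R := filtration_norm (y - x).

Let distxx x : dist x x = 0.
Proof. by rewrite /dist subrr filtration_norm0. Qed.

Let dist_positivity x y : dist x y = 0 -> x = y.
Proof. by move=> /filtration_norm_eq0/eqP; rewrite subr_eq0 => /eqP. Qed.

Let dist_sym x y : dist x y = dist y x.
Proof. by rewrite /dist -opprB filtration_normN. Qed.

Let dist_triangle y x z : dist x z <= dist x y + dist y z.
Proof.
by rewrite /dist -[in leLHS](subrK y z) -addrA addrC filtration_normD.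
Qed.

HB.instance Definition _ := isMetric.Build R M
  distxx dist_positivity dist_sym dist_triangle.

Lemma filtration_metric_ball n (x y : M) :
  ball x (n.+1%:R^-1 : R) y <-> H n (y - x).
Proof.
rewrite ballEmdist /= (_ : mdist x y = dist x y)// /dist filtration_norm_lt.
by split=> /asboolP.
Qed.

Lemma filtration_metric_nbhsP (x : M) (U : set M) :
  nbhs x U <-> exists n, forall y, H n (y - x) -> U y.
Proof.
split=> [/nbhs_ballP [e /= e0 eU]|[n HU]].
  have [n] := @ltr_add_invr R 0 e e0; rewrite add0r => /ltW ne.
  by exists n => y /filtration_metric_ball /(le_ball ne)/eU.
apply/nbhs_ballP; exists n.+1%:R^-1 => /=; first by rewrite invr_gt0 ltr0n.
by move=> y /filtration_metric_ball/HU.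
Qed.
End FiltrationNorm.

Lemma na_filtration_polish (R : realType) (G : topologicalZmodType)
    (H : nat -> set G) : na_filtration H -> polish R G.
Proof.
move=> [cH bH]; have sH := cf_sub cH; split.
  have [g Hg] := choice (cf_countable cH).
  exists (range (fun p => g p.1 p.2)).
    exact: card_le_trans (card_image_le _ _) (countableP _).
  move=> U [x Ux]; rewrite openE => /(_ x Ux)/(base0_nbhsP bH) [n HU].
  have [k xk] := Hg n x; exists (g n k); split; last by exists (n, k).
  by apply: HU; exact: subgroup_subC.
exists (filtration_metric R cH), idfun, idfun; split=> //.
- move=> x U /(filtration_metric_nbhsP x) [n HU].
  by apply/(base0_nbhsP bH); exists n.
- move=> x U /(base0_nbhsP bH) [n HU].
  by apply/(filtration_metric_nbhsP x); exists n.
move=> F FF /cauchyP cF.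
(* A Cauchy filter contains a coset of every level; representatives of these cosets form a sequence
   to which [cf_complete] applies. *)
have /choice [x Fx] n : exists x : G, F [set y | H n (y - x)].
  have [|x Fx] := cF n.+1%:R^-1; first by rewrite invr_gt0 ltr0n.
  by exists x; apply: filterS Fx => y /filtration_metric_ball.
have [|l Hl] := cf_complete cH (x := x).
  move=> n; have [y [/= yn yn1]] := filter_ex (filterI (Fx n) (Fx n.+1)).
  apply: (subgroup_trans (sH n) _ yn); apply: subgroup_subC => //.
  exact: cf_S cH _ _ yn1.
exists l => U /(filtration_metric_nbhsP l) [n HU].
apply: filterS (Fx n) => y /= yn; apply: HU.
by apply: (subgroup_trans (sH n) yn); exact: subgroup_subC.
Qed.

Section PolishFiltration.
Variables (R : realType) (G : topologicalZmodType).
Hypothesis pG : polish R G.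

Lemma polish_countable_base : exists U : nat -> set G,
  (forall n, nbhs 0 (U n)) /\
  forall V, nbhs 0 V -> exists n, U n `<=` V.
Proof.
have [_ [M [f [g [fK gK cf cg _]]]]] := pG.
exists (fun n => f @^-1` ball (f 0) n.+1%:R^-1); split=> [n|V V0].
  by apply: cf; apply: nbhsx_ballx; rewrite invr_gt0 ltr0n.
have /cg : nbhs (g (f 0)) V by rewrite fK.
move=> /nbhs_ballP [e /= e0 eV]; have [n] := @ltr_add_invr R 0 e e0.
rewrite add0r => /ltW ne; exists n => x /(le_ball ne)/eV /=.
by rewrite fK.
Qed.

Lemma polish_separated (x : G) : (forall U, nbhs 0 U -> U x) -> x = 0.
Proof.
have [_ [M [f [g [fK gK cf cg _]]]]] := pG.
move=> Ux; rewrite -(fK x) -(fK 0); congr g; apply/esym/mdist_positivity.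
apply/eqP; rewrite eq_le mdist_ge0 andbT leNgt; apply/negP => d0.
have /Ux /= : nbhs 0 (f @^-1` ball (f 0) (mdist (f 0) (f x))).
  by apply: cf; exact: nbhsx_ballx.
by rewrite ballEmdist /= ltxx.
Qed.

Lemma polish_dense_seq : exists g : nat -> G,
  forall (x : G) U, nbhs x U -> exists k, U (g k).
Proof.
have [[S cS dS] _] := pG.
have SU (x : G) U : nbhs x U -> (U `&` S) !=set0.
  rewrite nbhsE => -[V [oV Vx] VU].
  have [y [Vy Sy]] := dS V (ex_intro _ x Vx) oV.
  by exists y; split=> //; exact: VU.
have /pfcard_geP [S0|/unsquash s] := cS.
  by have := SU 0 setT filterT; rewrite S0 setI0 => -[].
exists s => x U /SU [y [Uy Sy]].
by have [k _ sk] := 'surj_s Sy; exists k; rewrite sk.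
Qed.

Variable H : nat -> set G.
Hypotheses (sH : forall n, subgroup (H n)) (HS : forall n, H n.+1 `<=` H n).
Hypothesis (bH : base0 H).

Let H_le m n : (m <= n)%N -> H n `<=` H m.
Proof.
move=> /subnK <-; elim: (n - m)%N => [|k IH] //.
by rewrite addSn => x /HS/IH.
Qed.

(* With xi the formal limit of the sequence, the translate [xi + G] meets [G]:
   both are comeagre in the completion of [G]. The proof unfolds the Baire
   category argument: it builds cosets of the [a_k] and of the [a_k - x_(n_k)]
   shrinking for the complete metric. *)
Lemma polish_group_complete (x : nat -> G) :
  (forall n, H n (x n.+1 - x n)) -> exists l, forall n, H n (l - x n).
Proof.
move=> Hx; have [_ [M [f [g [fK gK cf cg cplM]]]]] := pG.
have Hxle m n : (m <= n)%N -> H m (x n - x m).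
  move=> /subnK <-; elim: (n - m)%N => [|k IH].
    by rewrite add0n subrr; exact: subgroup0 (sH m).
  rewrite addSn; apply: (subgroup_trans (sH m) _ IH).
  by apply: (H_le (leq_addl k m)); exact: Hx.
have small (a : G) (k n0 : nat) : exists2 n, (n0 <= n)%N &
    forall y, H n (y - a) -> ball (f a) (k.+1%:R^-1 : R) (f y).
  have /cf : nbhs (f a) (ball (f a) (k.+1%:R^-1 : R)).
    by apply: nbhsx_ballx; rewrite invr_gt0 ltr0n.
  move=> /(base0_nbhsP bH) [n Hn]; exists (maxn n0 n); first exact: leq_maxl.
  by move=> y /(H_le (leq_maxr n0 n))/Hn.
pose small_coset k (a : G) n :=
  exists c : M, forall y, H n (y - a) -> ball c (k.+1%:R^-1 : R) (f y).
(* A state [(a, n)] keeps both [a + H n] and its translate [a - x n + H n] small for the complete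
   metric. *)
pose Q k (s : G * nat) := [/\ (k <= s.2)%N, small_coset k s.1 s.2
  & small_coset k (s.1 - x s.2) s.2].
pose S (s t : G * nat) := (s.2 <= t.2)%N /\ H s.2 (t.1 - s.1).
have step k (s : G * nat) : exists2 t, Q k t & S s t.
  case: s => a n; have [n1 nn1 an1] := small a k (maxn k n).
  have [n2 n12 bn2] := small (a - x n1) k n1.
  (* The new point [a - x n1 + x n2] stays in the coset of [a] modulo [H n1], and subtracting [x n2]
     gives back [a - x n1], around which [n2] was chosen. *)
  have Sa : H n1 (a - x n1 + x n2 - a).
    by rewrite (_ : _ - a = x n2 - x n1); [exact: Hxle|zmod].
  have [kn1 nn1'] : (k <= n1)%N /\ (n <= n1)%N.
    by move: nn1; rewrite geq_max => /andP.
  exists (a - x n1 + x n2, n2); last first.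
    by split=> /=; [exact: leq_trans nn1' n12|exact: H_le nn1' _ Sa].
  split=> /=; first exact: leq_trans kn1 n12.
    exists (f a) => y yn; apply: an1; apply: (subgroup_trans (sH n1) _ Sa).
    exact: H_le n12 _ yn.
  by exists (f (a - x n1)) => y yn; apply: bn2; rewrite addrK in yn.
have [s0 Qs0 _] := step 0%N (0, 0%N).
have [|u [_ Qu Su]] :=
    @dependent_choice_from _ Q (fun=> S) s0 Qs0.
  by move=> n t _; exact: step.
pose a k := (u k).1; pose m k := (u k).2; pose b k := a k - x (m k).
have mle i j : (i <= j)%N -> (m i <= m j)%N.
  move=> /subnK <-; elim: (j - i)%N => [|k IH] //.
  by rewrite addSn; apply: leq_trans IH (Su _).1.
have ale i j : (i <= j)%N -> H (m i) (a j - a i).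
  move=> /subnK <-; elim: (j - i)%N => [|k IH].
    by rewrite add0n subrr; exact: subgroup0 (sH _).
  rewrite addSn; apply: (subgroup_trans (sH _) _ IH).
  by apply: (H_le (mle _ _ (leq_addl k i))); exact: (Su _).2.
have ble i j : (i <= j)%N -> H (m i) (b j - b i).
  move=> ij; rewrite (_ : _ - _ = a j - a i - (x (m j) - x (m i))); last first.
    by rewrite /b; zmod.
  by apply: (subgroupB (sH _)); [exact: ale|exact/Hxle/mle].
(* Nested cosets with shrinking images have convergent centres, and the limit stays in each coset
   because cosets of open subgroups are closed. *)
have cvgM (c : nat -> G) : (forall i j, (i <= j)%N -> H (m i) (c j - c i)) ->
    (forall k, small_coset k (c k) (m k)) ->
    exists l, forall k, H (m k) (l - c k).
  move=> cle csmall.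
  have [|l fl] := cplM (f \o c @ \oo).
    apply: cauchy_exP => e e0; have [n] := @ltr_add_invr R 0 e e0.
    rewrite add0r => /ltW ne; have [z zc] := csmall n.
    by exists z, n => // k /= nk; apply/(le_ball ne)/zc/cle.
  exists (g l) => k.
  have /cg : nbhs (g l) (fun y => H (m k) (y - g l)).
    by apply/(base0_nbhsP bH); exists (m k).
  move=> /fl [N _ /(_ (maxn N k) (leq_maxl _ _))] /=; rewrite fK => cl.
  apply: (subgroup_trans (sH _) (y := c (maxn N k))).
    exact: subgroup_subC (sH _) _ _ cl.
  by apply: cle; exact: leq_maxr.
have [al Hal] : exists l, forall k, H (m k) (l - a k).
  by apply: cvgM ale _ => k; have [] := Qu k.
have [bl Hbl] : exists l, forall k, H (m k) (l - b k).
  by apply: cvgM ble _ => k; have [] := Qu k.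
(* Since [b k = a k - x (m k)], the difference of the two limits is the limit of [x]. *)
exists (al - bl) => n.
have nm : (n <= m n)%N by have [] := Qu n.
rewrite (_ : _ - _ = (al - a n) - (bl - b n) + (x (m n) - x n)); last first.
  by rewrite /b; zmod.
apply: (subgroupD (sH n)); last exact: Hxle.
by apply: (H_le nm); apply: (subgroupB (sH _)); [exact: Hal|exact: Hbl].
Qed.
End PolishFiltration.

(** [P] is a property wanted for every level: trivial for non-Archimedean groups, purity for type Z.
    Stability under intersection lets small subgroups be intersected into a decreasing sequence. *)
Lemma polish_filtration (R : realType) (G : topologicalZmodType)
    (P : set G -> Prop) : polish R G -> P setT ->
    (forall A B, P A -> P B -> P (A `&` B)) ->
    (forall U : set G, nbhs 0 U -> exists K : set G,
      [/\ subgroup K, nbhs 0 K, K `<=` U & P K]) ->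
  exists H : nat -> set G, na_filtration H /\ forall n, P (H n).
Proof.
move=> pG PT PI sub; have [U [U0 Ubase]] := polish_countable_base pG.
have /choice [K HK] n := sub _ (U0 n).
pose H := fix H n := if n is k.+1 then H k `&` K k else setT.
have sH n : subgroup (H n).
  elim: n => [|n IH] //=; apply: subgroupI => //.
  by have [] := HK n.
have HS n : H n.+1 `<=` H n by move=> x [].
have bH : base0 H.
  split=> [|V /Ubase [n UV]].
    elim=> [|n IH] /=; first exact: filterT.
    by apply: filterI => //; have [] := HK n.
  by exists n.+1 => x [_ Kx]; apply: UV; have [_ _ + _] := HK n; exact.
exists H; split; last by elim=> //= n IH; apply: PI => //; have [] := HK n.
split=> //; split=> //.
- by move=> x Hx; apply: (polish_separated pG) => V /bH.2 [n]; exact.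
- by move=> x; exact: (polish_group_complete pG sH HS bH).
- move=> n; have [g gd] := polish_dense_seq pG; exists g => x.
  have [k xk] : exists k, H n (g k - x).
    by apply: (gd x (fun y => H n (y - x))); apply/(base0_nbhsP bH); exists n.
  by exists k; exact: (subgroup_subC (sH n)).
Qed.

Lemma PAb_nAP (R : realType) (G : topologicalZmodType) :
  PAb_nA R G <-> exists H : nat -> set G, na_filtration H.
Proof.
split=> [[pG naG]|[H [cH bH]]].
  have [||U U0|H [cH _]] := polish_filtration (P := fun=> True) pG => //.
    have [K K0 KU] := naG _ U0.
    by exists [set` K]; split=> //; exact: zmodClosed_subgroup.
  by exists H.
split; first exact: (na_filtration_polish R (conj cH bH)).
move=> U /bH.2 [n HU]; exists (zmod_of_subgroup (cf_sub cH n));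
  rewrite set_zmod_of_subgroup//; exact: bH.1.
Qed.

(** * Quotients and type Z *)

Lemma pi_tquotB (G : topologicalZmodType) (N : zmodClosed G) (x y : G) :
  \pi_(tquot N) (x - y) = \pi_(tquot N) x - \pi_(tquot N) y.
Proof. exact: raddfB. Qed.

Lemma pi_tquot_eq (G : topologicalZmodType) (N : zmodClosed G) (x y : G) :
  \pi_(tquot N) x = \pi_(tquot N) y <-> x - y \in N.
Proof. by rewrite (Quotient.idealrBE N); split=> [->//|/eqP]. Qed.

Lemma pi_tquot_eq0 (G : topologicalZmodType) (N : zmodClosed G) (x : G) :
  \pi_(tquot N) x = 0 <-> x \in N.
Proof. by rewrite -[x in x \in N]subr0 -pi_tquot_eq raddf0. Qed.

Lemma pi_tquotMn (G : topologicalZmodType) (N : zmodClosed G) (x : G) n :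
  \pi_(tquot N) (x *+ n) = \pi_(tquot N) x *+ n.
Proof. exact: raddfMn. Qed.

Lemma pi_tquot_continuous (G : topologicalZmodType) (N : zmodClosed G) :
  continuous (\pi_(tquot N) : G -> tquot N).
Proof. by apply/continuousP => U. Qed.

Lemma pi_tquot_surj (G : topologicalZmodType) (N : zmodClosed G) (y : tquot N) :
  exists x, \pi_(tquot N) x = y.
Proof. by exists (repr y); rewrite reprK. Qed.

Definition chom_pi (G : topologicalZmodType) (N : zmodClosed G) : chom G (tquot N) :=
  @CHom G (tquot N) \pi_(tquot N) (@pi_tquot_continuous G N).

Lemma in_pi_image (G : topologicalZmodType) (N : zmodClosed G) (A : set G) x :
  (\pi_(tquot N) @` A) (\pi_(tquot N) x) <-> exists2 a, A a & x - a \in N.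
Proof.
split=> [[a Aa /esym/pi_tquot_eq xa]|[a Aa /pi_tquot_eq xa]].
  by exists a.
by exists a.
Qed.

(** Separation comes from the closedness of [N], completeness from lifting sequences to [G]. *)
Lemma quotient_filtration (G : topologicalZmodType) (H : nat -> set G)
    (N : zmodClosed G) : na_filtration H -> closed [set` N] ->
  na_filtration (fun n => \pi_(tquot N) @` H n).
Proof.
move=> [cH bH] clN; have sH := cf_sub cH; split; first split.
- by move=> n; exact: subgroup_image.
- rewrite (cf_T cH); apply/seteqP; split=> // y _.
  by have [x <-] := pi_tquot_surj y; exists x.
- by move=> n; apply: image_subset; exact: cf_S cH _.
- move=> y; have [x <-] := pi_tquot_surj y => xH; apply/pi_tquot_eq0.
  apply: ((base0_closedP bH _ sH).1 clN) => n.
  have /in_pi_image [a Ha xa] := xH n.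
  by exists (x - a) => //; rewrite opprB addrC subrK.
- move=> y Hy.
  have [x0 x0E] := pi_tquot_surj (y 0%N).
  (* The sequence is lifted term by term with increments in [H n], so that the lift converges in
     [G]. *)
  have [||x [_ xE xH]] := @dependent_choice_from _
      (fun n x => \pi_(tquot N) x = y n) (fun n x x' => H n (x' - x)) x0 => //.
    move=> n x xn; have [h Hh hE] := Hy n; exists (x + h).
      by rewrite raddfD /= hE xn addrC subrK.
    by rewrite addrC addKr.
  have [l Hl] := cf_complete cH xH; exists (\pi_(tquot N) l) => n.
  by rewrite -xE -pi_tquotB; exists (l - x n).
- move=> n; have [g gH] := cf_countable cH n; exists (fun k => \pi_(tquot N) (g k)).
  move=> y; have [x <-] := pi_tquot_surj y; have [k xk] := gH x.
  by exists k; rewrite -pi_tquotB; exists (x - g k).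
- split=> [n|U U0].
    apply: open_nbhs_nbhs; split; last first.
      exact: subgroup0 (subgroup_image _ (sH n)).
    rewrite /open /=; apply: subgroup_open.
      exact/subgroup_preim/subgroup_image.
    by apply: filterS (bH.1 n) => x Hx; exists x.
  have /bH.2 [n HU] : nbhs 0 (\pi_(tquot N) @^-1` U).
    by apply: (@pi_tquot_continuous G N 0); rewrite raddf0.
  by exists n => _ [x /HU Ux <-].
Qed.

Definition discrete_filtration (G : zmodType) (n : nat) : set G :=
  if n is 0 then setT else [set 0].

Lemma discrete_complete_filtration (G : zmodType) :
  (exists g : nat -> G, forall x, exists k, x = g k) ->
  complete_filtration (@discrete_filtration G).
Proof.
move=> [g gG]; split.
- case=> [|n]; first by split.
  by split=> //= x y -> ->; rewrite subrr.
- by [].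
- by case=> [|n] x.
- by move=> x /(_ 1%N).
- move=> x Hx; have xE n : x n.+1 = x 1%N.
    by elim: n => // n <-; apply/eqP; rewrite -subr_eq0; exact/eqP/(Hx n.+1).
  by exists (x 1%N); case=> //= n; rewrite xE subrr.
- move=> n; exists g => x; have [k ->] := gG x; exists k.
  by rewrite subrr; case: n => [|n].
Qed.

Lemma discrete_base0 (G : topologicalZmodType) :
  discrete G -> base0 (@discrete_filtration G).
Proof.
move=> dG; split=> [[|n]|U U0]; first exact: filterT.
  by apply: open_nbhs_nbhs; split=> //; exact: dG.
by exists 1%N => _ ->; exact: nbhs_singleton U0.
Qed.

Lemma discrete_tquot (G : topologicalZmodType) (N : zmodClosed G) :
  nbhs 0 [set` N] -> discrete (tquot N).
Proof.
move=> N0 y; have [x <-] := pi_tquot_surj y.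
rewrite /open /= openE => z /= /pi_tquot_eq zx; apply/nbhs_translate.
apply: filterS N0 => h /= Nh; apply/pi_tquot_eq.
by rewrite addrAC; exact: rpredD.
Qed.

Lemma discrete_tquot_nbhs (G : topologicalZmodType) (N : zmodClosed G) :
  discrete (tquot N) -> nbhs 0 [set` N].
Proof.
move=> /(_ 0) o0; rewrite (_ : [set` N] = \pi_(tquot N) @^-1` [set 0]).
  by apply: open_nbhs_nbhs; split=> //=; rewrite raddf0.
by apply/seteqP; split=> x /pi_tquot_eq0.
Qed.

Lemma rV0_eq (T : Type) (v w : 'rV[T]_0) : v = w.
Proof. by apply/matrixP => i []. Qed.

Lemma open_lie_kernel (R : realType) (G : topologicalZmodType) (H : nat -> set G)
    (N : zmodClosed G) : na_filtration H -> nbhs 0 [set` N] -> lie_kernel R N.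
Proof.
move=> [cH bH] N0; have sN := zmodClosed_subgroup N.
have [n HN] := bH.2 _ N0; have [g gH] := cf_countable cH n.
have gN : exists h : nat -> tquot N, forall x, exists k, x = h k.
  exists (fun k => \pi_(tquot N) (g k)) => y; have [x <-] := pi_tquot_surj y.
  by have [k /HN xk] := gH x; exists k; apply/pi_tquot_eq.
have dN := discrete_tquot N0.
split.
  apply/(base0_closedP bH _ (cf_sub cH)) => x /(_ n) [a Na /HN xa].
  by rewrite -(subrK a x); exact: subgroupD sN _ _ xa Na.
split.
  apply: (@na_filtration_polish R _ (@discrete_filtration (tquot N))); split.
    exact: discrete_complete_filtration.
  exact: discrete_base0.
(* The quotient is countable and discrete: a Lie group without real or toral factors. *)
exists 0%N, 0%N, (tquot N); split=> //.
  have [h hN] := gN.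
  have /subset_card_le le : [set: tquot N] `<=` range h.
    by move=> x _; have [k ->] := hN x; exists k.
  exact: card_le_trans le (card_le_trans (card_image_le _ _) (countableP _)).
exists (fun x => (0, 0, x)), (fun p => p.2); split=> //.
- by move=> x y; congr (_, _, _); apply: rV0_eq.
- by move=> [[v w] x] /=; congr (_, _, _); apply: rV0_eq.
- move=> x U [[A B] [/= A0 Bx] AB]; apply: filterS Bx => y By.
  by apply: (AB (0, 0, y)); split=> //=; exact: nbhs_singleton A0.
- by move=> p; exact: cvg_snd.
Qed.

Lemma row_cvg (R : realType) (T : topologicalType) (n : nat)
    (u : R -> 'rV[T]_n) (a : R) :
  (forall j, (u t ord0 j) @[t --> a] --> u a ord0 j) -> u t @[t --> a] --> u a.
Proof.
move=> ua A [P Pu PA].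
have : \forall t \near a, forall j, P ord0 j (u t ord0 j).
  apply: (@filter_forall R 'I_n (fun j t => P ord0 j (u t ord0 j)) (nbhs a) _) => j.
  exact: ua (Pu ord0 j).
by apply: filterS => t Pt; apply: PA => i j; rewrite ord1.
Qed.

(** For large k the value at t/k lies in a given level, and so does its k-th multiple, the value at
    t. *)
Lemma real_hom_na_eq0 (R : realType) (Q : topologicalZmodType) (K : nat -> set Q)
    (phi : R -> Q) : na_filtration K -> zmod_morphism phi ->
  (forall U : set Q, nbhs 0 U -> nbhs 0 (phi @^-1` U)) -> forall t, phi t = 0.
Proof.
move=> [cK bK] phiB phi0 t.
pose phi_mixin := GRing.isZmodMorphism.Build R Q phi phiB.
pose phi' : {additive R -> Q} := HB.pack phi phi_mixin.
apply: (cf_sep cK) => n; have /phi0/nbhs_ballP [e /= e0 eK] := bK.1 n.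
have [k te] : exists k, `|t| / k.+1%:R < e.
  exists (Num.truncn (`|t| / e)); rewrite ltr_pdivrMr ?ltr0n// mulrC -ltr_pdivrMr//.
  exact: truncnS_gt.
have -> : phi t = phi (t / k.+1%:R) *+ k.+1.
  have tE : t = t / k.+1%:R *+ k.+1 by rewrite -mulr_natr divfK// pnatr_eq0.
  by rewrite {1}tE; exact: (raddfMn phi').
apply: subgroupMn (cf_sub cK n) _ _ _; apply: eK.
by rewrite /ball /= sub0r normrN normrM normfV normr_nat.
Qed.

(** Every point of the real and toral factors lies on a one-parameter subgroup, which is trivial in
    a non-Archimedean group; only the discrete factor remains. *)
Lemma lie_kernel_open (R : realType) (G : topologicalZmodType) (H : nat -> set G)
    (N : zmodClosed G) : na_filtration H -> lie_kernel R N -> nbhs 0 [set` N].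
Proof.
move=> fH [clN [_ [n [d [D [dD _ [f [g [fB fK gK cf cg]]]]]]]]].
have fQ := quotient_filtration fH clN.
pose f_mixin := GRing.isZmodMorphism.Build _ _ f fB.
pose f' : {additive tquot N -> _} := HB.pack f f_mixin.
have f0 : f 0 = 0 by exact: (raddf0 f').
have gB x y : g (x - y) = g x - g y.
  by apply: (can_inj fK); rewrite fB !gK.
have g0 : g 0 = 0 by rewrite -f0 fK.
have gvw v w : g (v, w, 0) = 0.
  (* Lifting the coordinates of [w] to the real line gives a one-parameter subgroup that passes
     through [(v, w)] at time 1. *)
  pose w' (t : R) : 'rV[torus R]_d := \row_j \pi_(torus R) (t * repr (w ord0 j)).
  have -> : (v, w, 0) = (1 *: v, w' 1, 0 : D).
    congr (_, _, _); first by rewrite scale1r.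
    by apply/rowP => j; rewrite mxE mul1r reprK.
  apply: (real_hom_na_eq0 (phi := fun t => g (t *: v, w' t, 0)) fQ) => [s t|U U0].
    rewrite -gB; congr g; congr (_, _, _); last by rewrite subrr.
      by rewrite scalerBl.
    by apply/rowP => j; rewrite !mxE mulrBl pi_tquotB.
  have /cg : nbhs (g 0) U by rewrite g0.
  move=> [[A B] [/= [[A1 A2] [/= A10 A20] A12] B0] AB].
  have nA1 : \forall t \near (0 : R), A1 (t *: v).
    have : (t *: v) @[t --> (0 : R)] --> 0 *: v.
      apply: row_cvg => j; under eq_cvg do rewrite mxE; rewrite mxE.
      by apply: cvgM; [exact: cvg_id|exact: cvg_cst].
    by rewrite scale0r => /(_ _ A10).
  have nA2 : \forall t \near (0 : R), A2 (w' t).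
    have w'0 : w' 0 = 0.
      by apply/rowP => j; rewrite !mxE mul0r; apply/pi_tquot_eq0/rpred0.
    have : w' t @[t --> (0 : R)] --> w' 0.
      apply: row_cvg => j; under eq_cvg do rewrite mxE; rewrite mxE.
      apply: (@continuous_comp _ _ _ (fun t : R => t * repr (w ord0 j)) \pi_(torus R)).
        by apply: cvgM; [exact: cvg_id|exact: cvg_cst].
      exact: pi_tquot_continuous.
    by rewrite w'0 => /(_ _ A20).
  near=> t; apply: (AB (t *: v, w' t, 0)); split=> /=; last exact: nbhs_singleton B0.
  by apply: (A12 (t *: v, w' t)); split=> /=; near: t.
(* The fibre over 0 of the discrete factor is open, and its preimage in [G] lies in [N] by [gvw]. *)
have : nbhs (f 0) [set p | p.2 = 0].
  rewrite f0; exists (setT, [set 0]); last by move=> p [].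
  by split=> /=; [exact: filterT|apply: open_nbhs_nbhs; split=> //; exact: dD].
move=> /cf; rewrite -(raddf0 \pi_(tquot N)) => /(@pi_tquot_continuous G N 0) N0.
apply: (@filterS _ _ (nbhs_filter (0 : G)) _ _ _ N0) => x /= fx.
apply/pi_tquot_eq0; rewrite -(fK (\pi_(tquot N) x)).
by case: (f _) fx => -[v w] z /= ->.
Unshelve. all: by end_near. Qed.

(** For a subgroup, this means that the quotient is torsion-free. *)
Definition pure (G : zmodType) (A : set G) : Prop :=
  forall x n, (0 < n)%N -> A (x *+ n) -> A x.

(** Type Z refines small Lie kernels to open pure subgroups. Conversely a Lie kernel is open, so it
    contains a pure level, whose quotient is discrete and torsion-free. *)
Lemma proLiePAb_ZP (R : realType) (G : topologicalZmodType) :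
  proLiePAb_Z R G <->
  exists H : nat -> set G, na_filtration H /\ forall n, pure (H n).
Proof.
split=> [[pG lG zG]|[H [fH pH]]].
  apply: (polish_filtration pG) => // [A B pA pB x n n0 [] /(pA _ _ n0) Ax /(pB _ _ n0) Bx|].
    by split.
  move=> U /lG [N /zG [N' [_ N'N dN' tN']] NU]; exists [set` N']; split.
  - exact: zmodClosed_subgroup.
  - exact: discrete_tquot_nbhs.
  - exact: subset_trans N'N NU.
  - move=> x n n0 /= /pi_tquot_eq0; rewrite pi_tquotMn => /tN' xn.
    exact/pi_tquot_eq0/xn.
have [cH bH] := fH.
have HN n : nbhs 0 [set` zmod_of_subgroup (cf_sub cH n)].
  by rewrite set_zmod_of_subgroup; exact: bH.1.
split; first exact: na_filtration_polish fH.
  move=> U /bH.2 [n HU]; exists (zmod_of_subgroup (cf_sub cH n)).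
    exact: (open_lie_kernel R fH).
  by rewrite set_zmod_of_subgroup.
move=> N /(lie_kernel_open fH)/bH.2 [n HN'].
exists (zmod_of_subgroup (cf_sub cH n)); split.
- exact: (open_lie_kernel R fH).
- by rewrite set_zmod_of_subgroup.
- exact: discrete_tquot.
- move=> y k k0; have [x <-] := pi_tquot_surj y.
  rewrite -pi_tquotMn => /pi_tquot_eq0/in_zmod_of_subgroup/(pH _ _ _ k0) Hx.
  exact/pi_tquot_eq0/in_zmod_of_subgroup.
Qed.

(** * Groups defined by a filtration *)

(** An alias of [G] that records the filtration in its type, so that the topology it defines can be
    inferred. *)
Definition filtered (G : zmodType) (H : nat -> set G)
  (_ : complete_filtration H) : Type := G.

Section Filtered.
Variables (G : zmodType) (H : nat -> set G) (cH : complete_filtration H).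

Let fopen (U : set G) : Prop :=
  forall x, U x -> exists n, forall h, H n h -> U (x + h).

Let fopenT : fopen setT. Proof. by move=> x _; exists 0%N. Qed.

Let fopenI : setI_closed fopen.
Proof.
move=> U V oU oV x [/oU [m Um] /oV [n Vn]]; exists (maxn m n) => h Hh.
by split; [apply: Um (cf_le cH (leq_maxl m n) Hh)|apply: Vn (cf_le cH (leq_maxr m n) Hh)].
Qed.

Let fopen_bigU (I : Type) (f : I -> set G) :
  (forall i, fopen (f i)) -> fopen (\bigcup_i f i).
Proof.
by move=> fo x [i _ /fo [n fin]]; exists n => h /fin; exists i.
Qed.

HB.instance Definition _ := GRing.Zmodule.on (filtered cH).
HB.instance Definition _ :=
  isOpenTopological.Build (filtered cH) fopenT fopenI fopen_bigU.

Let nbhs_filteredP (x : filtered cH) (U : set (filtered cH)) :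
  nbhs x U <-> exists n, forall y, H n (y - x) -> U y.
Proof.
rewrite nbhsE; split=> [[V [oV Vx] VU]|[n HU]].
  have [n Vn] := oV x Vx; exists n => y /Vn; rewrite addrC subrK; exact: VU.
exists (fun y => H n (y - x)) => //; split; last first.
  by rewrite subrr; exact: subgroup0 (cf_sub cH n).
move=> y yx; exists n => h Hh; rewrite addrAC.
exact: subgroupD (cf_sub cH n) _ _ yx Hh.
Qed.

Let filtered_sub_continuous :
  continuous (fun z : filtered cH * filtered cH => z.1 - z.2).
Proof.
move=> [a b] /= W /nbhs_filteredP [n HW].
exists ((fun x => H n (x - a)), (fun x => H n (x - b))).
  by split; apply/nbhs_filteredP; exists n.
move=> [x y] /= [xa yb]; apply: HW.
rewrite (_ : _ - _ = (x - a) - (y - b)); last by zmod.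
exact: subgroupB (cf_sub cH n) _ _ xa yb.
Qed.

HB.instance Definition _ :=
  PreTopologicalNmodule_isTopologicalZmodule.Build (filtered cH)
    filtered_sub_continuous.

Lemma filtered_na : @na_filtration (filtered cH) H.
Proof.
split; first by case: (cH) => *; split.
split=> [n|U /nbhs_filteredP [n HU]].
  by apply/nbhs_filteredP; exists n => y; rewrite subr0.
by exists n => x Hx; apply: HU; rewrite subr0.
Qed.
End Filtered.

Definition subzmod (G : zmodType) (N : zmodClosed G) : Type := {x : G | x \in N}.

Section SubZmod.
Variables (G : zmodType) (N : zmodClosed G).

HB.instance Definition _ := SubChoice.on (subzmod N).
HB.instance Definition _ := [SubChoice_isSubZmodule of subzmod N by <:].

Lemma sub_filtration (H : nat -> set G) : complete_filtration H ->
    (forall x, (forall n, exists2 a, a \in N & H n (x - a)) -> x \in N) ->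
  complete_filtration (fun n => (val : subzmod N -> G) @^-1` H n).
Proof.
move=> cH clN; have sH := cf_sub cH; split.
- by move=> n; exact: subgroup_preim.
- by rewrite (cf_T cH).
- by move=> n x /=; exact: cf_S cH _ _.
- by move=> x /(cf_sep cH) x0; exact: val_inj.
- move=> x Hx; have [|l Hl] := cf_complete cH (x := fun n => val (x n)).
    by move=> n; exact: Hx.
  have Nl : l \in N by apply: clN => n; exists (val (x n)); [exact: valP|].
  by exists (exist _ l Nl) => n; exact: Hl.
- move=> n; have [g gH] := cf_countable cH n.
  (* The representative [g k] may lie outside [N]: it is replaced by an element of [N] in the same
     coset, or by 0 if there is none. *)
  have /choice [h hH] k : exists y : subzmod N,
      forall x : subzmod N, H n (val x - g k) -> H n (val (x - y)).
    have [[y yk]|nex] := pselect (exists y : subzmod N, H n (val y - g k)).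
      exists y => x xk; apply: (subgroup_trans (sH n) xk).
      exact: (subgroup_subC (sH n)).
    by exists 0 => x xk; case: nex; exists x.
  by exists h => x; have [k xk] := gH (val x); exists k; exact: hH.
Qed.
End SubZmod.

Lemma prod_filtration (G1 G2 : zmodType) (H1 : nat -> set G1) (H2 : nat -> set G2) :
  complete_filtration H1 -> complete_filtration H2 ->
  complete_filtration (fun n => (H1 n `*` H2 n) : set (G1 * G2)%type).
Proof.
move=> c1 c2; split.
- move=> n; split=> [|[x1 x2] [y1 y2] [/= ? ?] [/= ? ?]].
    by split; [exact: subgroup0 (cf_sub c1 n)|exact: subgroup0 (cf_sub c2 n)].
  by split; [exact: subgroupB (cf_sub c1 n) _ _ _ _|exact: subgroupB (cf_sub c2 n) _ _ _ _].
- by rewrite (cf_T c1) (cf_T c2) setXTT.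
- by move=> n [x y] [? ?]; split; [exact: (cf_S c1)|exact: (cf_S c2)].
- move=> [x y] Hxy; congr (_, _).
    by apply: (cf_sep c1) => n; have [] := Hxy n.
  by apply: (cf_sep c2) => n; have [] := Hxy n.
- move=> x Hx.
  have [|l1 Hl1] := cf_complete c1 (x := fun n => (x n).1).
    by move=> n; have [] := Hx n.
  have [|l2 Hl2] := cf_complete c2 (x := fun n => (x n).2).
    by move=> n; have [] := Hx n.
  by exists (l1, l2) => n; split; [exact: Hl1|exact: Hl2].
- move=> n; have [g1 gH1] := cf_countable c1 n; have [g2 gH2] := cf_countable c2 n.
  exists (fun k => if unpickle k is Some (i, j) then (g1 i, g2 j) else 0) => -[x y].
  have [i xi] := gH1 x; have [j yj] := gH2 y; exists (pickle (i, j)).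
  by rewrite pickleK.
Qed.

(** The basic neighborhoods of 0 in a countable power of the discrete group [D]. *)
Definition tail (D : zmodType) (n : nat) : set (nat -> D) :=
  [set x | forall i, (i < n)%N -> x i = 0].

Lemma tail_filtration (D : zmodType) :
  (exists g : nat -> D, forall x, exists k, x = g k) ->
  complete_filtration (@tail D).
Proof.
move=> [g gD]; split.
- by move=> n; split=> [|x y x0 y0] i ni //; rewrite !fctE x0// y0// subrr.
- by apply/seteqP; split=> // x _ [].
- by move=> n x xn i ni; apply: xn; exact: leqW.
- by move=> x xn; apply/funext => i; exact: (xn i.+1).
(* Coordinate i no longer changes from stage i+1 on. *)
- move=> x Hx; exists (fun i => x i.+1 i) => n i ni; rewrite !fctE.
  rewrite -(subnK ni); elim: (n - i.+1)%N => [|k IH]; first by rewrite add0n subrr.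
  rewrite addSn -[in RHS]IH; congr (_ - _).
  by apply/eqP; rewrite -subr_eq0; apply/eqP/(Hx _ i); rewrite leq_addl.
- move=> n; exists (fun k i => g (nth 0%N (odflt [::] (unpickle k)) i)) => x.
  have /choice [s sE] i : exists k, x i = g k by exact: gD.
  exists (pickle (mkseq s n)) => i ni; rewrite !fctE pickleK /= nth_mkseq//.
  by rewrite -sE subrr.
Qed.

Lemma countable_enum (D : countType) (d : D) :
  exists g : nat -> D, forall x, exists k, x = g k.
Proof. by exists (fun k => odflt d (unpickle k)) => x; exists (pickle x); rewrite pickleK. Qed.

(** * Homomorphisms and short exact sequences *)

Definition chom_of (A B : topologicalZmodType) (f : A -> B)
    (fB : zmod_morphism f) (cf : continuous f) : chom A B :=
  let f_mixin := GRing.isZmodMorphism.Build A B f fB in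
  @CHom A B (HB.pack_for {additive A -> B} f f_mixin) cf.

Lemma chomB (A B : topologicalZmodType) (f : chom A B) x y : f (x - y) = f x - f y.
Proof. exact: raddfB. Qed.

Lemma chomD (A B : topologicalZmodType) (f : chom A B) x y : f (x + y) = f x + f y.
Proof. exact: raddfD. Qed.

Lemma chom0 (A B : topologicalZmodType) (f : chom A B) : f 0 = 0.
Proof. exact: raddf0. Qed.

Lemma chomMn (A B : topologicalZmodType) (f : chom A B) x n : f (x *+ n) = f x *+ n.
Proof. exact: raddfMn. Qed.

Definition chom_comp (A B C : topologicalZmodType) (g : chom B C) (f : chom A B) :
    chom A C.
Proof.
apply: (@chom_of _ _ (g \o f)) => [x y|x] /=; first by rewrite !chomB.
by apply: continuous_comp; exact: chom_continuous.
Defined.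

Definition chom_sub (A B : topologicalZmodType) (f g : chom A B) : chom A B.
Proof.
apply: (@chom_of _ _ (fun x => f x - g x)) => [x y|x].
  by rewrite !chomB; zmod.
apply: (@continuous_comp _ _ _ (fun x => (f x, g x)) (fun z : B * B => z.1 - z.2)).
  by apply: cvg_pair; exact: chom_continuous.
exact: sub_continuous.
Defined.

Definition chom_add (A B : topologicalZmodType) (f g : chom A B) : chom A B.
Proof.
apply: (@chom_of _ _ (fun x => f x + g x)) => [x y|x].
  by rewrite !chomB; zmod.
apply: (@continuous_comp _ _ _ (fun x => (f x, g x)) (fun z : B * B => z.1 + z.2)).
  by apply: cvg_pair; exact: chom_continuous.
exact: add_continuous.
Defined.

Definition chom_zero (A B : topologicalZmodType) : chom A B.
Proof.
by apply: (@chom_of _ _ (fun=> 0)) => [x y|x]; [rewrite subrr|exact: cvg_cst].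
Defined.

Lemma chom_base0 (A B : topologicalZmodType) (HA : nat -> set A) (HB : nat -> set B)
    (f : chom A B) : base0 HA -> base0 HB ->
  forall n, exists m, forall x, HA m x -> HB n (f x).
Proof.
move=> bA bB.
exact: (base0_continuousP (chom_fun f) bA bB).1 (@chom_continuous _ _ f).
Qed.

Definition base0_chom (A B : topologicalZmodType) (HA : nat -> set A)
    (HB : nat -> set B) (f : A -> B) (fB : zmod_morphism f) (bA : base0 HA)
    (bB : base0 HB) (cf : forall n, exists m, forall x, HA m x -> HB n (f x)) :
  chom A B :=
  let f_mixin := GRing.isZmodMorphism.Build A B f fB in
  let f' := HB.pack_for {additive A -> B} f f_mixin in
  @CHom A B f' ((base0_continuousP f' bA bB).2 cf).

(** A uniform limit of morphisms: modulo level n it agrees with [k n], which gives additivity by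
    separation and continuity level by level. *)
Lemma chom_lim (A B : topologicalZmodType) (HA : nat -> set A) (HB : nat -> set B)
    (k : nat -> chom A B) : base0 HA -> na_filtration HB ->
    (forall n x, HB n (k n.+1 x - k n x)) ->
  exists l : chom A B, forall n x, HB n (l x - k n x).
Proof.
move=> bA [cB bB] Hk; have sB := cf_sub cB.
have /choice [l Hl] x : exists y, forall n, HB n (y - k n x).
  exact: (cf_complete cB (x := fun n => k n x)).
have lB : zmod_morphism l.
  move=> x y; apply/eqP; rewrite -subr_eq0; apply/eqP/(cf_sep cB) => n.
  have := subgroupB (sB n) (Hl (x - y) n) (subgroupB (sB n) (Hl x n) (Hl y n)).
  by rewrite chomB; congr HB; zmod.
have lC n : exists m, forall x, HA m x -> HB n (l x).
  have [m Hm] := chom_base0 (k n) bA bB n; exists m => x /Hm.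
  by move=> /(subgroupD (sB n) (Hl x n)); rewrite subrK.
by exists (base0_chom lB bA bB lC) => n x; exact: Hl.
Qed.

Lemma na_filtration_eq (B : topologicalZmodType) (HB : nat -> set B) (x y : B) :
  na_filtration HB -> (forall n, HB n (x - y)) -> x = y.
Proof.
move=> [cB _] xy; apply/eqP; rewrite -subr_eq0; apply/eqP; exact: (cf_sep cB).
Qed.

(** * The open mapping theorem *)

Section OpenMapping.
Variables (B C : topologicalZmodType) (HB : nat -> set B) (HC : nat -> set C).
Hypotheses (fB : na_filtration HB) (fC : na_filtration HC).
Variables (p : chom B C) (p_surj : forall y, exists x, p x = y).

Let cB := fB.1.
Let cC := fC.1.
Let sB := cf_sub cB.
Let sC := cf_sub cC.

(* [L n] is the closure of the image of [HB n]. *)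
Let L n (y : C) := forall k, exists2 x, HB n x & HC k (y - p x).

Let sL n : subgroup (L n).
Proof.
split=> [k|y z Ly Lz k].
  exists 0; first exact: subgroup0 (sB n).
  by rewrite chom0 subrr; exact: subgroup0 (sC k).
have [u Hu yu] := Ly k; have [v Hv zv] := Lz k; exists (u - v).
  exact: subgroupB (sB n) _ _ Hu Hv.
rewrite (_ : _ - _ = (y - p u) - (z - p v)); last by rewrite chomB; zmod.
exact: subgroupB (sC k) _ _ yu zv.
Qed.

Let L_closed n y : (forall k, exists2 z, L n z & HC k (y - z)) -> L n y.
Proof.
move=> Ly k; have [z /(_ k) [x Hx zx] yz] := Ly k; exists x => //.
exact: (subgroup_trans (sC k) yz).
Qed.

(* Baire category: countably many translates of the closed subgroup [L n]
   cover [C]. *)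
Let L_open n : exists m, HC m `<=` L n.
Proof.
apply: contrapT => /forallNP nL.
have [g gB] := cf_countable cB n.
(* If no level lies in [L n], shrinking cosets [x + HC m] avoid the translates of [L n] by the
   [p (g j)] one after the other. Their common point would avoid all of these, which cover [C]. *)
pose Q (j : nat) (s : C * nat) := (j <= s.2)%N.
pose S (j : nat) (s t : C * nat) := [/\ (s.2 <= t.2)%N, HC s.2 (t.1 - s.1)
  & forall z, HC t.2 (z - t.1) -> ~ L n (z - p (g j))].
have [//||u [_ Qu Su]] := @dependent_choice_from _ Q S (0, 0%N).
  move=> j [x m] jm.
  (* A point of the translate leaves it when moved by an element of [HC m] outside [L n]. *)
  have [x' [Hx' Lx']] : exists x', HC m (x' - x) /\ ~ L n (x' - p (g j)).
    have [Lx|Lx] := pselect (L n (x - p (g j))); last first.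
      by exists x; split=> //; rewrite subrr; exact: subgroup0 (sC m).
    have [y Hy Ly] : exists2 y, HC m y & ~ L n y.
      apply: contrapT => nex; apply: (nL m) => y Hy.
      by apply: contrapT => Ly; apply: nex; exists y.
    exists (x + y); split; first by rewrite (_ : _ - x = y) //; zmod.
    move=> Lxy; apply: Ly; rewrite (_ : y = (x + y - p (g j)) - (x - p (g j))).
      exact: subgroupB (sL n) _ _ Lxy Lx.
    by zmod.
  have [k Hk] : exists k, forall z, HC k (z - x') -> ~ L n (z - p (g j)).
    apply: contrapT => /forallNP nk; apply: Lx'; apply: L_closed => k.
    apply: contrapT => nz; apply: (nk k) => z zx Lz; apply: nz.
    exists (z - p (g j)) => //; rewrite (_ : _ - _ = x' - z); last by zmod.
    exact: subgroup_subC (sC k) _ _ zx.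
  exists (x', maxn k (maxn j.+1 m)).
    by rewrite /Q /= !leq_max leqnn orbT.
  split=> //=; first by rewrite !leq_max leqnn !orbT.
  by move=> z zx; apply: Hk; exact: (cf_le cC (leq_maxl _ _) zx).
have ule i j : (j <= i)%N ->
    ((u j).2 <= (u i).2)%N /\ HC (u j).2 ((u i).1 - (u j).1).
  move=> /subnK <-; elim: (i - j)%N => [|d [le IH]].
    by rewrite add0n subrr; split=> //; exact: subgroup0 (sC _).
  rewrite addSn; have [le' Hu _] := Su (d + j)%N; split; first exact: leq_trans le'.
  by apply: (subgroup_trans (sC _) _ IH); exact: (cf_le cC le Hu).
have [|l Hl] := cf_complete cC (x := fun j => (u j).1).
  by move=> j; have [_ Hu _] := Su j; exact: (cf_le cC (Qu j) Hu).
have [x xl] := p_surj l; have [j xj] := gB x.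
have [_ _ /(_ l)] := Su j; apply.
  pose i := maxn j.+1 (u j.+1).2.
  have [_ ui] := ule i j.+1 (leq_maxl _ _).
  apply: (subgroup_trans (sC _) _ ui).
  exact: (cf_le cC (leq_maxr _ _) (Hl i)).
move=> k; exists (x - g j) => //.
by rewrite chomB xl subrr; exact: subgroup0 (sC k).
Qed.

(** An element of the closure of the image of a level is approximated by images with smaller and
    smaller corrections; by completeness of [B] these sum to an exact preimage. *)
Lemma open_mapping n : exists m, HC m `<=` p @` HB n.
Proof.
have [M HM] := choice L_open.
exists (M n) => y yn.
pose Q j (u : B) := HB n u /\ HC (M (n + j)%N) (y - p u).
pose S j (u v : B) := HB (n + j)%N (v - u) /\ HC j (y - p v).
have [||u [_ Qu Su]] := @dependent_choice_from _ Q S 0.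
- by split; [exact: subgroup0 (sB n)|rewrite addn0 chom0 subr0].
- move=> j u [Hu yu]; have [v Hv yv] := HM _ _ yu (maxn (M (n + j.+1)%N) j).
  rewrite (_ : _ - _ = y - p (u + v)) in yv; last by rewrite chomD; zmod.
  exists (u + v); split.
  + exact: subgroupD (sB n) _ _ Hu (cf_le cB (leq_addr j n) Hv).
  + exact: (cf_le cC (leq_maxl _ _) yv).
  + by rewrite (_ : _ - _ = v) //; zmod.
  + exact: (cf_le cC (leq_maxr _ _) yv).
have uS j : HB j (u j.+1 - u j).
  by have [Hu _] := Su j; exact: (cf_le cB (leq_addl n j) Hu).
have [l Hl] := cf_complete cB uS; exists l.
  by rewrite -(subrK (u n) l); apply: subgroupD (sB n) _ _ (Hl n) (Qu n).1.
apply: (na_filtration_eq fC) => k; have [m Hm] := chom_base0 p fB.2 fC.2 k.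
pose j := maxn m k.
rewrite (_ : _ - _ = p (l - u j.+1) - (y - p (u j.+1))); last first.
  by rewrite chomB; zmod.
apply: (subgroupB (sC k)).
  by apply: Hm; apply: (cf_le cB _ (Hl j.+1)); rewrite leqW// leq_maxl.
by apply: (cf_le cC (leq_maxr m k) _); have [] := Su j.
Qed.

Lemma chom_factor (Q : topologicalZmodType) (HQ : nat -> set Q) (f : chom B Q) :
    base0 HQ -> (forall x, p x = 0 -> f x = 0) ->
  exists c : chom C Q, forall x, c (p x) = f x.
Proof.
move=> bQ pf; have [r rK] := choice p_surj.
have cE x : f (r (p x)) = f x.
  by apply/eqP; rewrite -subr_eq0 -chomB; apply/eqP/pf; rewrite chomB rK subrr.
have cM : zmod_morphism (fun y => f (r y)).
  by move=> x y; rewrite -(rK x) -(rK y) -chomB !cE chomB.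
have cont n : exists m, forall y, HC m y -> HQ n (f (r y)).
  have [m Hm] := chom_base0 f fB.2 bQ n; have [k Hk] := open_mapping m.
  by exists k => _ /Hk [x /Hm fx <-]; rewrite cE.
by exists (base0_chom cM fC.2 bQ cont).
Qed.
End OpenMapping.

(** * Closed embeddings and closed subgroups *)

Section ClosedEmbedding.
Variables (A B : topologicalZmodType) (HA : nat -> set A) (HB : nat -> set B).
Hypotheses (fA : na_filtration HA) (fB : na_filtration HB).
Variable i : chom A B.

Lemma chom_closed_embedding :
  (forall n, exists m, forall a, HB m (i a) -> HA n a) -> closed_embedding i.
Proof.
have [[cA bA] [cB bB]] := (fA, fB).
have [sA sB] := (cf_sub cA, cf_sub cB).
move=> /choice [M HM].
have i_inj : injective i.
  move=> x y xy; apply: (na_filtration_eq fA) => n; apply: (HM n).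
  by rewrite chomB xy subrr; exact: subgroup0 (sB _).
split.
  apply/(base0_closedP bB _ sB) => b Hb.
  (* Approximating [b] to order [K n] gives convergence to [b], and puts the images of consecutive
     approximants within [HB (M n)] of each other; [M n.-1] serves the later of the two. *)
  pose K n := maxn n (maxn (M n) (M n.-1)).
  have KM n : (M n <= K n)%N by rewrite !leq_max leqnn !orbT.
  have KMS n : (M n <= K n.+1)%N by rewrite !leq_max leqnn !orbT.
  have /choice [a Ha] n : exists a, HB (K n) (b - i a).
    by have [_ [a _ <-] ba] := Hb (K n); exists a.
  have [|l Hl] := cf_complete cA (x := a).
    move=> n; apply: (HM n).
    rewrite (_ : i _ = (b - i (a n)) - (b - i (a n.+1))); last first.
      by rewrite chomB; zmod.
    apply: (subgroupB (sB _)); first exact: (cf_le cB (KM n) (Ha n)).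
    exact: (cf_le cB (KMS n) (Ha n.+1)).
  exists l => //; apply/esym/(na_filtration_eq fB) => k.
  have [m Hm] := chom_base0 i bA bB k; pose n := maxn k m.
  rewrite (_ : _ - _ = (b - i (a n)) - i (l - a n)); last first.
    by rewrite chomB; zmod.
  apply: (subgroupB (sB _)); last exact/Hm/(cf_le cA (leq_maxr k m) (Hl n)).
  apply: (cf_le cB _ (Ha n)); apply: leq_trans (leq_maxl k m) (leq_maxl _ _).
have /choice [g gE] b : exists a, forall a', i a' = b -> a = a'.
  have [[a ab]|nab] := pselect (exists a, i a = b); last first.
    by exists 0 => a' a'b; case: nab; exists a'.
  by exists a => a' a'b; apply: i_inj; rewrite ab.
exists g; first by move=> a; exact: gE.
apply/subspace_continuousP => _ [a _ <-] U.
rewrite /from_subspace; have -> : g (i a) = a by exact: gE.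
move=> /(base0_nbhsP bA) [n HU]; apply/(base0_nbhsP bB).
exists (M n) => _ /[swap] -[a' _ <-] aa'.
rewrite /preimage /mkset (gE (i a') a')//.
by apply/HU/HM; rewrite chomB.
Qed.

Lemma closed_embedding_base : closed_embedding i ->
  forall n, exists m, forall a, HB m (i a) -> HA n a.
Proof.
have [[cA bA] [cB bB]] := (fA, fB).
move=> [_ [g gK /subspace_continuousP cg]] n.
have r0 : range i 0 by exists 0 => //; exact: chom0.
have g0 : g 0 = 0 by rewrite -(chom0 i) gK.
have /(cg 0 r0) : nbhs (from_subspace (range i) g 0) (HA n).
  by rewrite /from_subspace g0; exact: bA.1.
move=> /bB.2 [m Hm]; exists m => a Ha.
by have := Hm _ Ha (imageT i a); rewrite /preimage /mkset /from_subspace gK.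
Qed.

Lemma closed_embedding_inj : closed_embedding i -> injective i.
Proof. by move=> [_ [g gK _]]; exact: can_inj gK. Qed.
End ClosedEmbedding.

Lemma chom_lift (A B P : topologicalZmodType) (i : chom A B) (h : chom P B) :
    closed_embedding i -> (forall x, range i (h x)) ->
  exists k : chom P A, forall x, i (k x) = h x.
Proof.
move=> [_ [g gK /subspace_continuousP cg]] ih.
have gh x : i (g (h x)) = h x by have [a _ <-] := ih x; rewrite gK.
have gB : zmod_morphism (fun x => g (h x)).
  by move=> x y; apply: (can_inj gK); rewrite gh !chomB !gh.
have gC : continuous (fun x => g (h x)).
  move=> x U /(cg _ (ih x)) /= gU.
  have := @chom_continuous _ _ h x _ gU; rewrite /= => hU.
  by apply: (@filterS _ _ (nbhs_filter x) _ _ _ hU) => y /=; apply; exact: ih.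
by exists (chom_of gB gC).
Qed.

Lemma tquot_short_exact (A B : topologicalZmodType) (i : chom A B)
    (N : zmodClosed B) : closed_embedding i -> range i = [set` N] ->
  short_exact i (chom_pi N).
Proof.
move=> ci iN; split=> //.
  by rewrite iN; apply/seteqP; split=> x /= /pi_tquot_eq0.
by apply/seteqP; split=> // y _; have [x <-] := pi_tquot_surj y; exists x.
Qed.

Lemma short_exact_surj (A B C : topologicalZmodType) (i : chom A B) (p : chom B C) :
  short_exact i p -> forall y, exists x, p x = y.
Proof.
move=> [_ _ pT] y; have : range p y by rewrite pT.
by move=> [x _ <-]; exists x.
Qed.

Lemma short_exact_ker (A B C : topologicalZmodType) (i : chom A B) (p : chom B C) :
  short_exact i p -> forall x, p x = 0 <-> exists a, i a = x.
Proof.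
move=> [_ ip _] x; rewrite -[p x = 0]/((p @^-1` [set 0]) x) -ip.
by split=> [[a _ ax]|[a ax]]; exists a.
Qed.

Lemma short_exact_comp (A B C : topologicalZmodType) (i : chom A B) (p : chom B C) :
  short_exact i p -> forall a, p (i a) = 0.
Proof. by move=> ex a; apply/(short_exact_ker ex); exists a. Qed.

Section Subgroup.
Variables (B : topologicalZmodType) (HB : nat -> set B) (N : zmodClosed B).
Hypotheses (fB : na_filtration HB) (clN : closed [set` N]).

Let cN : complete_filtration (fun n => (val : subzmod N -> B) @^-1` HB n).
Proof. exact: sub_filtration fB.1 ((base0_closedP fB.2 _ (cf_sub fB.1)).1 clN). Qed.

Definition closed_subgroup : topologicalZmodType := filtered cN.

Lemma closed_subgroup_na : @na_filtration closed_subgroup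
  (fun n => (val : subzmod N -> B) @^-1` HB n).
Proof. exact: filtered_na. Qed.

Definition chom_incl : chom closed_subgroup B.
Proof.
apply: (@base0_chom closed_subgroup B _ HB (val : subzmod N -> B) _
  closed_subgroup_na.2 fB.2) => // n.
by exists n.
Defined.

Lemma chom_incl_closed_embedding : closed_embedding chom_incl.
Proof. by apply: (chom_closed_embedding closed_subgroup_na fB) => n; exists n. Qed.

Lemma range_chom_incl : range chom_incl = [set` N].
Proof.
apply/seteqP; split=> [_ [x _ <-]|x Nx]; first exact: (valP (x : subzmod N)).
by exists (exist _ x Nx).
Qed.
End Subgroup.

(** * Extension into divisible groups *)

Definition divisible (G : zmodType) (A : set G) : Prop :=
  forall x n, (0 < n)%N -> A x -> exists2 y, A y & y *+ n = x.

Section DivisibleExtension.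
Variables (B D : zmodType) (E : set D).
Hypotheses (sE : subgroup E) (dE : divisible E).

(** Graphs of homomorphisms from subgroups of [B] to [E]: the second clause is single-valuedness. *)
Let good (Y : set (B * D)) : Prop :=
  [/\ subgroup Y, forall d, Y (0, d) -> d = 0 & forall y, Y y -> E y.2].

Let pairMz (x : B * D) (k : int) : x *~ k = (x.1 *~ k, x.2 *~ k).
Proof.
by rewrite [LHS]surjective_pairing; congr (_, _);
  [exact: (raddfMz fst)|exact: (raddfMz snd)].
Qed.

(** The step of Baer's criterion: if n is the least positive integer such that the domain contains n
    b, then b is sent to an n-th root in [E] of the value there, and to 0 if no such n exists. *)
Let good_step (Y : set (B * D)) (b : B) : good Y ->
  exists Y', [/\ good Y', Y `<=` Y' & exists d, Y' (b, d)].
Proof.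
move=> [sY Y0 YE].
have [d' Ed' d'P] : exists2 d', E d' & forall (k : int) e, Y (b *~ k, e) -> e = d' *~ k.
  pose P n := (0 < n)%N && `[< exists d, Y (b *+ n, d) >].
  have [exP|nex] := pselect (exists n, P n).
    have [n /andP[n0 /asboolP [d Yd]] minn] := ex_minnP exP.
    have [d' Ed' /= d'n] := dE n0 (YE _ Yd); exists d' => // k e Ye.
    (* By minimality of n, the remainder of k modulo n vanishes. *)
    have kE := divz_eq k n.
    set q := (k %/ n)%Z in kE; set r := (k %% n)%Z in kE.
    have r0 : 0 <= r by apply: modz_ge0; lia.
    have rn : r < n by apply: ltz_pmod; lia.
    have Yr : Y (b *~ r, e - d *~ q).
      have := subgroupB sY Ye (subgroupMz sY q Yd); rewrite pairMz /=.
      congr (Y _); congr (_, _); rewrite -[b *+ n]/(b *~ n%:Z) -mulrzA -mulrzBr.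
      by congr (_ *~ _); rewrite {1}kE mulrC; ring.
    have r_eq0 : r = 0.
      case: r r0 rn Yr {kE} => // -[//|r] _ rn Yr.
      have /minn : P r.+1 by apply/andP; split=> //; apply/asboolP; eexists; exact: Yr.
      by rewrite leqNgt; move: rn; rewrite ltz_nat => ->.
    move: Yr; rewrite r_eq0 mulr0z => /Y0/eqP; rewrite subr_eq0 => /eqP ->.
    by rewrite -d'n -[d' *+ n]/(d' *~ n%:Z) -mulrzA kE r_eq0 addr0 mulrC.
  exists 0; first exact: subgroup0.
  move=> k e Ye; suff k0 : k = 0.
    by move: Ye; rewrite k0 mulr0z mulr0z => /Y0.
  case: k Ye => [[//|k]|k] Ye; case: nex.
    by exists k.+1; apply/andP; split=> //; apply/asboolP; exists e.
  exists k.+1; apply/andP; split=> //; apply/asboolP; exists (- e).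
  move: Ye; rewrite NegzE mulrNz => /(subgroupN sY).
  by rewrite -[- (_, _)]/(- _, - _) opprK.
exists [set z | exists2 y, Y y & exists k : int, z = y + (b, d') *~ k]; split.
- split.
  + split=> [|_ _ [x Yx [k ->]] [y Yy [l ->]]].
      by exists 0; [exact: subgroup0|exists 0; rewrite mulr0z addr0].
    exists (x - y); first exact: subgroupB.
    by exists (k - l); rewrite mulrzBr; zmod.
  + move=> d [[y1 y2] Yy [k]]; rewrite pairMz => -[/= e1 ->].
    have y1E : y1 = - (b *~ k) by apply/eqP; rewrite -addr_eq0 -e1.
    have /d'P <- : Y (b *~ k, - y2).
      by have := subgroupN sY Yy; rewrite -[- (_, _)]/(- _, - _) y1E opprK.
    by rewrite addrN.
  + move=> _ [y Yy [k ->]]; rewrite pairMz /=.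
    by apply: subgroupD; [|exact: YE|exact: subgroupMz].
- by move=> y Yy; exists y => //; exists 0; rewrite mulr0z addr0.
- by exists d', 0; [exact: subgroup0|exists 1; rewrite mulr1z add0r].
Qed.

Lemma divisible_extension (Gr : set (B * D)) : subgroup Gr ->
    (forall d, Gr (0, d) -> d = 0) -> (forall y, Gr y -> E y.2) ->
  exists g : B -> D, [/\ zmod_morphism g, forall x, E (g x)
    & forall b d, Gr (b, d) -> g b = d].
Proof.
(* Zorn's lemma runs over the sets whose union with [Gr] is good, so that the empty chain is covered
   by [Gr] itself. *)
move=> sGr Gr0 GrE; pose P (X : set (B * D)) := good (X `|` Gr).
have Pchain (F : set (set (B * D))) : F `<=` P -> total_on F subset ->
    P (\bigcup_(X in F) X).
  move=> FP tF.
  have up x y : (\bigcup_(X in F) X `|` Gr) x -> (\bigcup_(X in F) X `|` Gr) y ->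
      exists X, [/\ good X, X x, X y & X `<=` \bigcup_(X in F) X `|` Gr].
    have FU X : F X -> X `|` Gr `<=` \bigcup_(X in F) X `|` Gr.
      by move=> FX z [Xz|Gz]; [left; exists X|right].
    move=> [[X FX Xx]|Gx] [[Z FZ Zy]|Gy].
    - have [XZ|ZX] := tF _ _ FX FZ.
        exists (Z `|` Gr); split; [exact: FP|left; exact: XZ|by left|exact: FU].
      exists (X `|` Gr); split; [exact: FP|by left|left; exact: ZX|exact: FU].
    - by exists (X `|` Gr); split; [exact: FP|left|right|exact: FU].
    - by exists (Z `|` Gr); split; [exact: FP|right|left|exact: FU].
    - by exists Gr; split=> // z; right.
  split.
  - split=> [|x y xU yU]; first by right; exact: subgroup0.
    have [X [[sX _ _] Xx Xy XU]] := up x y xU yU.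
    by apply: XU; exact: subgroupB.
  - move=> d dU; have [X [[_ X0 _] Xd _ _]] := up _ _ dU dU; exact: X0.
  - move=> y yU; have [X [[_ _ XE] Xy _ _]] := up _ _ yU yU; exact: XE.
have [A [PA maxA]] := Zorn_bigcup Pchain.
set Y := A `|` Gr in PA *; have [sY Y0 YE] := PA.
have /choice [g Yg] b : exists d, Y (b, d).
  have [Y' [gY' YY' [d Y'd]]] := good_step b PA.
  have Y'A : Y' `<=` A.
    apply: contrapT => nY'A; apply: (maxA Y').
      by split=> // z Az; apply: YY'; left.
    by rewrite /P setUidl// => z Gz; apply: YY'; right.
  by exists d; left; exact: Y'A.
have gE b d : Y (b, d) -> g b = d.
  move=> Yd; apply/eqP; rewrite -subr_eq0; apply/eqP/Y0.
  by have := subgroupB sY (Yg b) Yd; rewrite -[_ - _]/(b - b, g b - d) subrr.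
exists g; split=> [x y|x|b d Gd].
- by apply: gE; exact: subgroupB sY _ _ (Yg x) (Yg y).
- exact: YE (Yg x).
- by apply: gE; right.
Qed.
End DivisibleExtension.

(* An open subgroup [HI n.+1] that is divisible splits off, so the extension
   is found modulo [HI n] by successive approximations. *)
Lemma divisible_extend (A B I : topologicalZmodType) (HA : nat -> set A)
    (HB : nat -> set B) (HI : nat -> set I) (i : chom A B) (h : chom A I) :
    na_filtration HA -> na_filtration HB -> na_filtration HI ->
    (forall n, divisible (HI n)) -> closed_embedding i ->
  exists k : chom B I, forall a, k (i a) = h a.
Proof.
move=> fA fB fI dI ci.
have [[cA bA] [[cB bB] [cI bI]]] := (fA, (fB, fI)).
have [sB sI] := (cf_sub cB, cf_sub cI).
have emb := closed_embedding_base fA fB ci.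
pose Q n (k : chom B I) := forall a, HI n (h a - k (i a)).
pose S n (k k' : chom B I) := forall x, HI n (k' x - k x).
have [|n k Qk|k [_ Qk Sk]] := @dependent_choice_from _ Q S (chom_zero B I).
- by move=> a; rewrite (cf_T cI).
- have [hk hkE] : exists hk : chom A I, forall a, hk a = h a - k (i a).
    by exists (chom_sub h (chom_comp k i)).
  (* [rho] is an additive retraction of [I] onto [HI n.+1], so [x - rho x] vanishes on this open
     subgroup. *)
  have [|||rho [rhoB rhoE rhoid]] := @divisible_extension I I (HI n.+1) (sI _) (dI _)
      [set z | HI n.+1 z.1 /\ z.1 = z.2].
  + split=> [|[x1 x2] [y1 y2] [/= Hx <-] [/= Hy <-]].
      by split=> //=; exact: subgroup0.
    by split=> //=; exact: subgroupB.
  + by move=> d [_ /= <-].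
  + by move=> [x y] [/= Hx <-].
  have [m Hm] := chom_base0 hk bA bI n.+1.
  have [m' Hm'] := emb m.
  have qB x y : (x - y) - rho (x - y) = (x - rho x) - (y - rho y).
    by rewrite rhoB; zmod.
  have q0 x : HI n.+1 x -> x - rho x = 0.
    by move=> Hx; rewrite (rhoid x x) ?subrr.
  (* [delta] extends [hk - rho hk] from [A] to [B] with values in [HI n] and vanishes on [HB m'],
     hence is continuous. Adding it to [k] leaves the error [rho hk], which lies in [HI n.+1]. *)
  have [|||delta [deltaB deltaE deltaid]] := @divisible_extension B I (HI n) (sI _) (dI _)
      [set z | exists a u, [/\ HB m' u, z.1 = i a + u & z.2 = hk a - rho (hk a)]].
  + split=> [|[x1 x2] [y1 y2] [a [u [/= Hu -> ->]]] [b [v [/= Hv -> ->]]]].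
      exists 0, 0; split; first exact: subgroup0.
        by rewrite chom0 addr0.
      by rewrite chom0 q0//; exact: subgroup0.
    exists (a - b), (u - v); split; first exact: subgroupB (sB _) _ _ Hu Hv.
      by rewrite /= chomB; zmod.
    by rewrite chomB qB.
  + move=> d [a [u [/= Hu iau ->]]]; apply/q0/Hm/Hm'.
    have -> : i a = - u by apply/eqP; rewrite -addr_eq0 -iau.
    exact: (subgroupN (sB _) Hu).
  + move=> [x y] [a [u [/= _ _ ->]]]; apply: (subgroupB (sI n)); first by rewrite hkE; exact: Qk.
    exact: (cf_S cI (rhoE _)).
  have deltaC j : exists m, forall x, HB m x -> HI j (delta x).
    exists m' => x Hx; rewrite (deltaid x 0); first exact: subgroup0 (sI j).
    exists 0, x; split=> //=; first by rewrite chom0 add0r.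
    by rewrite chom0 q0//; exact: subgroup0.
  pose delta' := base0_chom deltaB bB bI deltaC.
  exists (chom_add k delta').
    move=> a; rewrite -[chom_add k delta' _]/(k (i a) + delta (i a)).
    rewrite (deltaid (i a) (hk a - rho (hk a))).
      rewrite hkE (_ : _ - _ = rho (hk a)) //; rewrite hkE; zmod.
    by exists a, 0; split; rewrite ?addr0//; exact: subgroup0.
  move=> x; rewrite -[chom_add k delta' _]/(k x + delta x).
  by rewrite (_ : _ - _ = delta x)//; zmod.
have [l Hl] := chom_lim bB fI Sk.
exists l => a; apply: (na_filtration_eq fI) => n.
have := subgroupB (sI n) (Hl n (i a)) (Qk n a); rewrite (_ : _ - _ = l (i a) - h a) //.
by zmod.
Qed.

(** * Sequences of polynomials *)

(** [{poly int}] serves as the free abelian group on the monomials; this is the homomorphism that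
    sends ['X^k] to [b k]. *)
Definition poly_hom (B : zmodType) (b : nat -> B) (f : {poly int}) : B :=
  \sum_(k < size f) b k *~ f`_k.

Section PolyHom.
Variables (B : zmodType) (b : nat -> B).

Lemma poly_hom_wide (f : {poly int}) (n : nat) :
  (size f <= n)%N -> poly_hom b f = \sum_(k < n) b k *~ f`_k.
Proof.
move=> fn; rewrite /poly_hom (big_ord_widen n (fun k => b k *~ f`_k) fn) big_mkcond /=.
apply: eq_bigr => k _; case: ltnP => // fk.
by rewrite nth_default// mulr0z.
Qed.

Lemma poly_homB : zmod_morphism (poly_hom b).
Proof.
move=> f g; pose n := maxn (size (f - g)) (maxn (size f) (size g)).
rewrite !(@poly_hom_wide _ n) ?leq_max ?leqnn ?orbT// -sumrB.
by apply: eq_bigr => k _; rewrite coefB mulrzBr.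
Qed.

Lemma poly_hom0 : poly_hom b 0 = 0.
Proof. by rewrite /poly_hom size_poly0 big_ord0. Qed.

Lemma poly_homXn k : poly_hom b 'X^k = b k.
Proof.
rewrite (@poly_hom_wide _ k.+1) ?size_polyXn// (bigD1 ord_max)//= coefXn eqxx.
rewrite big1 ?addr0// => i ik; rewrite coefXn (_ : (val i == k) = false) ?mulr0z//.
by rewrite -val_eqE /= in ik; exact: negPf.
Qed.

Lemma poly_hom_in (A : set B) f : subgroup A -> (forall k, A (b k)) -> A (poly_hom b f).
Proof. by move=> sA Ab; apply: subgroup_sum => // k _; exact: subgroupMz. Qed.
End PolyHom.

Lemma poly_hom_unique (B C : zmodType) (b : nat -> B) (phi : {poly int} -> C)
    (p : {additive B -> C}) : zmod_morphism phi ->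
  (forall k, p (b k) = phi 'X^k) -> forall f, p (poly_hom b f) = phi f.
Proof.
move=> phiB pb f.
pose phi_mixin := GRing.isZmodMorphism.Build _ _ phi phiB.
pose phi' : {additive {poly int} -> C} := HB.pack phi phi_mixin.
rewrite raddf_sum -[f in RHS]coefK poly_def -[phi]/(phi' : _ -> _) raddf_sum.
apply: eq_bigr => k _; rewrite raddfMz pb -[phi]/(phi' : _ -> _) -raddfMz.
by rewrite -mul_polyC -[f`_k in RHS]intz rmorph_int mulrzl.
Qed.

Definition seq_group (D : zmodType)
    (eD : exists g : nat -> D, forall x, exists k, x = g k) : topologicalZmodType :=
  filtered (tail_filtration eD).

Lemma seq_group_na (D : zmodType)
    (eD : exists g : nat -> D, forall x, exists k, x = g k) :
  @na_filtration (seq_group eD) (@tail D).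
Proof. exact: filtered_na. Qed.

(** The countable power of the free abelian group of countable rank: a projective object that
    surjects onto every object. *)
Definition int_seq : topologicalZmodType :=
  seq_group (countable_enum (0 : {poly int})).

Definition int_seq_na : @na_filtration int_seq (@tail {poly int}) :=
  seq_group_na (countable_enum (0 : {poly int})).

Definition rat_seq : topologicalZmodType :=
  seq_group (countable_enum (0 : {poly rat})).

Definition rat_seq_na : @na_filtration rat_seq (@tail {poly rat}) :=
  seq_group_na (countable_enum (0 : {poly rat})).

Section IntSeq.
Variables (B : topologicalZmodType) (HB : nat -> set B).
Hypothesis (fB : na_filtration HB).

Let cB := fB.1.
Let sB := cf_sub cB.

Lemma partial_hom (b : nat -> nat -> B) (n : nat) : exists d : chom int_seq B,
  forall x : nat -> {poly int}, d x = \sum_(i < n) poly_hom (b i) (x i).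
Proof.
pose d (x : nat -> {poly int}) := \sum_(i < n) poly_hom (b i) (x i).
have dB : zmod_morphism (d : int_seq -> B).
  move=> x y; rewrite /d -sumrB; apply: eq_bigr => i _.
  by rewrite -poly_homB.
have dC k : exists m, forall x : int_seq, tail m x -> HB k (d x).
  exists n => x xn; apply: (subgroup_sum (sB k)) => i _.
  by rewrite xn// poly_hom0; exact: subgroup0.
by exists (base0_chom dB int_seq_na.2 fB.2 dC).
Qed.

(** The n-th factor is sent into [HB n], its monomials onto representatives modulo [HB n.+1]; every
    element is the sum of a series of such representatives. *)
Lemma int_seq_surjection : exists s : chom int_seq B, forall y, exists x, s x = y.
Proof.
have /choice [g gH] n : exists g : nat -> B,
    (forall k, HB n (g k)) /\ forall x, HB n x -> exists k, HB n.+1 (x - g k).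
  have [g0 g0H] := cf_countable cB n.+1.
  have /choice [g gP] k : exists y, HB n y /\
      forall x, HB n x -> HB n.+1 (x - g0 k) -> HB n.+1 (x - y).
    have [[y [Hy yk]]|nex] := pselect (exists y, HB n y /\ HB n.+1 (y - g0 k)).
      exists y; split=> // x Hx xk; apply: (subgroup_trans (sB _) xk).
      exact: (subgroup_subC (sB _)).
    exists 0; split=> [|x Hx xk]; first exact: subgroup0.
    by case: nex; exists x.
  exists g; split=> [k|x Hx]; first by have [] := gP k.
  by have [k xk] := g0H x; exists k; have [_] := gP k; apply.
have /choice [s sE] n := partial_hom g n.
have [|l Hl] := chom_lim (k := s) int_seq_na.2 fB.
  move=> n x; rewrite !sE big_ord_recr /= addrAC subrr add0r.
  by apply: poly_hom_in => // k; have [] := gH n.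
exists l => y.
pose Q n (z : B) := HB n (y - z).
pose S n (z z' : B) := exists k, z' = z + g n k.
have [||u [u0 Qu Su]] := @dependent_choice_from _ Q S 0.
- by rewrite /Q (cf_T cB).
- move=> n z Hz; have [_ /(_ _ Hz) [k zk]] := gH n.
  by exists (z + g n k); [rewrite /Q opprD addrA|exists k].
have [c cE] := choice Su.
(* The preimage has a single monomial in each factor. *)
exists (fun n => 'X^(c n)); apply/esym/(na_filtration_eq fB) => n.
have us : s n (fun n => 'X^(c n)) = u n.
  rewrite sE; elim: n => [|n IH]; first by rewrite big_ord0.
  by rewrite big_ord_recr /= IH poly_homXn cE.
have := subgroupB (sB n) (Qu n) (Hl n (fun n => 'X^(c n))).
by rewrite us (_ : _ - _ = y - l (fun n => 'X^(c n))) //; zmod.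
Qed.

Variables (C : topologicalZmodType) (HC : nat -> set C).
Hypothesis (fC : na_filtration HC).
Variables (p : chom B C) (p_surj : forall y, exists x, p x = y).

Let cC := fC.1.
Let sC := cf_sub cC.

(** Successive approximation: at stage n, the error of the lift is the image under [p] of an element
    of [HB n]. *)
Lemma int_seq_lift (h : chom int_seq C) :
  exists k : chom int_seq B, forall x, p (k x) = h x.
Proof.
pose Q n (k : chom int_seq B) := forall x, exists2 b, HB n b & p b = h x - p (k x).
pose S n (k k' : chom int_seq B) := forall x, HB n (k' x - k x).
have [|n k Qk|k [_ Qk Sk]] := @dependent_choice_from _ Q S (chom_zero int_seq B).
- by move=> x; have [b bE] := p_surj (h x - p 0); exists b; rewrite ?(cf_T cB).
- have [hk hkE] : exists hk : chom int_seq C, forall a, hk a = h a - p (k a).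
    by exists (chom_sub h (chom_comp p k)).
  (* On [tail N] the error already lies in the image of [HB n.+1]. Only the first N coordinates need
     correcting, and there values in [HB n] may be prescribed freely on the monomials. *)
  have [m Hm] := open_mapping fB fC p_surj n.+1.
  have [N HN] := chom_base0 hk int_seq_na.2 fC.2 m.
  pose single i (f : {poly int}) : nat -> {poly int} :=
    fun j => if j == i then f else 0.
  have /choice [b bE] i : exists b : nat -> B,
      forall k, HB n (b k) /\ p (b k) = hk (single i 'X^k).
    have /choice [b bP] j : exists b, HB n b /\ p b = hk (single i 'X^j).
      by have [b Hb bE] := Qk (single i 'X^j); exists b; rewrite hkE.
    by exists b.
  have [d dE] := partial_hom b N.
  exists (chom_add k d); last first.
    move=> x; rewrite -[chom_add k d _]/(k x + d x).
    rewrite (_ : _ - _ = d x); last by zmod.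
    rewrite dE; apply: (subgroup_sum (sB n)) => i _; apply: poly_hom_in => // j.
    by have [] := bE i j.
  have pd x : p (d x) = hk (\sum_(i < N) single i (x i)).
    rewrite dE !raddf_sum; apply: eq_bigr => i _.
    apply: (@poly_hom_unique _ _ _ (fun f => hk (single i f))) => [f g|j].
      rewrite -chomB; congr (hk _); apply/funext => j.
      by rewrite !fctE /single; case: eqP => // _; rewrite subr0.
    by have [] := bE i j.
  move=> x; have [y Hy yE] : exists2 y, HB n.+1 y & p y = hk (x - \sum_(i < N) single i (x i)).
    apply: Hm; apply: HN => j jN; rewrite !fctE fct_sumE.
    rewrite (bigD1 (Ordinal jN))//= /single eqxx big1 ?addr0 ?subrr// => i ij.
    by rewrite ifN// eq_sym.
  exists y => //; rewrite yE -[chom_add k d _]/(k x + d x) chomB -pd hkE chomD.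
  by zmod.
have [l Hl] := chom_lim int_seq_na.2 fB Sk.
exists l => x; apply: (na_filtration_eq fC) => n.
have [m Hm] := chom_base0 p fB.2 fC.2 n; have [b Hb bE] := Qk m x.
rewrite (_ : _ - _ = p (l x - k m x) - p b); last by rewrite bE chomB; zmod.
by apply: (subgroupB (sC n)); exact: Hm.
Qed.
End IntSeq.

(** * Embeddings into divisible groups and lifting *)

Lemma divisible_image (G H : zmodType) (f : {additive G -> H}) (A : set G) :
  divisible A -> divisible (f @` A).
Proof.
move=> dA _ n n0 [x /(dA _ _ n0) [y Ay <-] <-].
by exists (f y); [exists y|rewrite raddfMn].
Qed.

Lemma tail_rat_divisible n : divisible (@tail {poly rat} n).
Proof.
move=> x k k0 xn; exists (fun i => k%:R^-1 *: x i).
  by move=> i ni; rewrite xn// scaler0.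
have kR : (k%:R : rat) != 0 by rewrite pnatr_eq0 -lt0n.
apply/funext => i; have -> : forall (y : nat -> {poly rat}) m, (y *+ m) i = y i *+ m.
  by move=> y; elim=> [|m IH]; rewrite ?mulr0n// !mulrS fctE IH.
by rewrite -scaler_nat scalerA divff// scale1r.
Qed.

Lemma int_to_rat_seq : exists iota : chom int_seq rat_seq,
  (forall (x : nat -> {poly int}) i, (iota x : nat -> {poly rat}) i = map_poly intr (x i)).
Proof.
pose iota (x : nat -> {poly int}) (i : nat) : {poly rat} := map_poly intr (x i).
have iB : zmod_morphism (iota : int_seq -> rat_seq).
  by move=> x y; apply/funext => i; rewrite /iota !fctE raddfB.
have iC n : exists m, forall x : int_seq, tail m x -> tail n (iota x).
  by exists n => x xn i ni; rewrite /iota xn// raddf0.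
by exists (base0_chom iB int_seq_na.2 rat_seq_na.2 iC).
Qed.

(** [B] is [int_seq] modulo the kernel of [s]; this kernel stays closed in [rat_seq], and the
    quotient of [rat_seq] by it contains [B]. *)
Lemma divisible_embedding (B : topologicalZmodType) (HB : nat -> set B) :
    na_filtration HB -> exists (I : topologicalZmodType) (HI : nat -> set I) (j : chom B I),
  [/\ na_filtration HI, forall n, divisible (HI n) & closed_embedding j].
Proof.
move=> fB; have [s s_surj] := int_seq_surjection fB.
have [iota iotaE] := int_to_rat_seq.
have iota_tail n x : tail n (iota x : nat -> {poly rat}) -> tail n (x : nat -> {poly int}).
  move=> xn i ni; have := xn i ni; rewrite iotaE => /polyP x0.
  by apply/polyP => k; have := x0 k; rewrite coef_map !coef0 => /eqP; rewrite intr_eq0 => /eqP.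
have sM : subgroup (iota @` (s @^-1` [set 0])).
  apply/subgroup_image/subgroup_preim; split=> // x y -> ->.
  by rewrite /set1 /mkset subrr.
pose N := zmod_of_subgroup sM.
have NP x : x \in N <-> exists2 y, s y = 0 & iota y = x.
  by rewrite in_zmod_of_subgroup; split=> [[y]|[y]]; exists y.
have clN : closed [set` N].
  apply/(base0_closedP rat_seq_na.2 _ (cf_sub rat_seq_na.1)) => x Hx.
  have /choice [a Ha] n : exists a : int_seq, s a = 0 /\ tail n (x - iota a : nat -> {poly rat}).
    by have [_ /NP [a a0 <-] xa] := Hx n; exists a.
  pose y : int_seq := fun i => a i.+1 i.
  have yx : iota y = x.
    apply/funext => i; rewrite iotaE; have [_ /(_ i (ltnSn i))] := Ha i.+1.
    by rewrite !fctE iotaE => /eqP; rewrite subr_eq0 => /eqP.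
  apply/NP; exists y => //; apply: (cf_sep fB.1) => k.
  have [n Hn] := chom_base0 s int_seq_na.2 fB.2 k; have [a0 xa] := Ha n.
  rewrite -(subr0 (s y)) -a0 -chomB; apply/Hn/iota_tail.
  by rewrite chomB yx.
have fI := quotient_filtration rat_seq_na clN.
have [j jE] := chom_factor int_seq_na fB s_surj (f := chom_comp (chom_pi N) iota) fI.2
  (fun x sx => (pi_tquot_eq0 N _).2 ((NP _).2 (ex_intro2 _ _ x sx erefl))).
exists (tquot N), (fun n => \pi_(tquot N) @` (@tail {poly rat} n)), j.
split; first exact: fI.
  by move=> n; apply: divisible_image; exact: tail_rat_divisible.
(* If [x] lies in [tail m] up to an element [y] of the kernel, then [s x = s (x - y)] is small. *)
apply: (chom_closed_embedding fB fI) => n.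
have [m Hm] := chom_base0 s int_seq_na.2 fB.2 n; exists m => b.
have [x <-] := s_surj b; rewrite jE => /in_pi_image [v Hv /NP [y sy yE]].
rewrite -(subr0 (s x)) -sy -chomB; apply/Hm/iota_tail.
by rewrite chomB yE (_ : _ - _ = v)//; zmod.
Qed.

(* Over a hereditary ring, submodules of projectives are projective because
   quotients of injectives are injective: [p] is replaced by the quotient map
   of an embedding of [B] into a divisible group. *)
Lemma subgroup_int_seq_lift (K B C : topologicalZmodType) (HK : nat -> set K)
    (HB : nat -> set B) (HC : nat -> set C) (e : chom K int_seq) (p : chom B C)
    (h : chom K C) : na_filtration HK -> na_filtration HB -> na_filtration HC ->
    closed_embedding e -> (forall y, exists x, p x = y) ->
  exists k : chom K B, forall x, p (k x) = h x.
Proof.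
move=> fK fB fC ce p_surj.
have [I [HI [j [fI dI cj]]]] := divisible_embedding fB.
have embj := closed_embedding_base fB fI cj.
have j_inj := closed_embedding_inj cj.
have sM : subgroup (j @` (p @^-1` [set 0])).
  apply/subgroup_image/subgroup_preim; split=> // x y -> ->.
  by rewrite /set1 /mkset subrr.
pose N := zmod_of_subgroup sM.
have NP x : x \in N <-> exists2 y, p y = 0 & j y = x.
  by rewrite in_zmod_of_subgroup; split=> [[y]|[y]]; exists y.
have clN : closed [set` N].
  apply/(base0_closedP fI.2 _ (cf_sub fI.1)) => x Hx.
  have [b _ bx] : range j x.
    apply: ((base0_closedP fI.2 _ (cf_sub fI.1)).1 cj.1) => n.
    by have [_ /NP [a _ <-] xa] := Hx n; exists (j a) => //; exists a.
  apply/NP; exists b => //; apply: (cf_sep fC.1) => k.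
  have [m Hm] := chom_base0 p fB.2 fC.2 k; have [n Hn] := embj m.
  have [_ /NP [a a0 <-] xa] := Hx n.
  by rewrite -(subr0 (p b)) -a0 -chomB; apply/Hm/Hn; rewrite chomB bx.
have fQ := quotient_filtration fI clN.
have [c cE] := chom_factor fB fC p_surj (f := chom_comp (chom_pi N) j) fQ.2
  (fun x px => (pi_tquot_eq0 N _).2 ((NP _).2 (ex_intro2 _ _ x px erefl))).
have c_inj y : c y = 0 -> y = 0.
  have [x <-] := p_surj y; rewrite cE => /pi_tquot_eq0/NP [b pb].
  by move=> /j_inj <-.
have dQ n : divisible (\pi_(tquot N) @` HI n) by exact: divisible_image.
(* [c] embeds [C] into the divisible quotient of [I]. There [c h] extends from [K] to [int_seq], the
   extension lifts to [I], and on [K] this lift takes values in the image of [B]. *)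
have [h' h'E] := divisible_extend (chom_comp c h) fK int_seq_na fQ dQ ce.
have [h'' h''E] := int_seq_lift fI fQ (p := chom_pi N) (@pi_tquot_surj _ N) h'.
have hj x : exists2 b, p b = h x & j b = h'' (e x).
  have [b pb] := p_surj (h x).
  have /pi_tquot_eq/NP [a pa ja] : \pi_(tquot N) (h'' (e x)) = \pi_(tquot N) (j b).
    by have := h''E (e x); rewrite h'E /= => ->; rewrite -pb cE.
  exists (b + a); first by rewrite chomD pa addr0.
  by rewrite chomD ja; zmod.
have [|k kE] := chom_lift (h := chom_comp h'' e) cj.
  by move=> x; have [b _ bx] := hj x; exists b.
exists k => x; have [b <- bx] := hj x; congr (p _); apply: j_inj.
by rewrite kE bx.
Qed.

(** * Objects of the two categories *)

(** The flag [z] adds purity, that is type Z, so that both categories are treated at once. *)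
Definition na_class (z : bool) (G : topologicalZmodType) : Prop :=
  exists H : nat -> set G, na_filtration H /\ (z -> forall n, pure (H n)).

Lemma torsion_free_pure (G : zmodType) :
  (forall (x : G) n, (0 < n)%N -> x *+ n = 0 -> x = 0) -> pure [set (0 : G)].
Proof. by move=> tG x n n0 /(tG _ _ n0). Qed.

Lemma poly_int_torsion_free (f : {poly int}) n : (0 < n)%N -> f *+ n = 0 -> f = 0.
Proof.
move=> n0 /polyP fn; apply/polyP => k; have := fn k.
by rewrite coefMn !coef0 => /eqP; rewrite mulrn_eq0 eqn0Ngt n0 /= => /eqP.
Qed.

Lemma int_seq_class z : na_class z int_seq.
Proof.
exists (@tail {poly int}); split=> [|_ n x k k0 xn i ni]; first exact: int_seq_na.
apply: (poly_int_torsion_free k0); rewrite -(xn i ni).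
by elim: k {k0 xn} => [|k IH]; rewrite ?mulr0n// !mulrS fctE IH.
Qed.

Lemma closed_subgroup_class (z : bool) (B : topologicalZmodType) (HB : nat -> set B)
    (N : zmodClosed B) (fB : na_filtration HB) (clN : closed [set` N]) :
  (z -> forall n, pure (HB n)) -> na_class z (closed_subgroup fB clN).
Proof.
move=> pB; exists (fun n => (val : subzmod N -> B) @^-1` HB n).
split=> [|/pB pHB n x k k0]; first exact: closed_subgroup_na.
rewrite /preimage /mkset => Hxk; apply: (pHB n _ k k0); move: Hxk.
by rewrite (raddfMn (chom_incl fB clN)).
Qed.

Section Product.
Variables (A B : topologicalZmodType) (HA : nat -> set A) (HB : nat -> set B).
Hypotheses (fA : na_filtration HA) (fB : na_filtration HB).

Definition product : topologicalZmodType := filtered (prod_filtration fA.1 fB.1).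

Lemma product_na : @na_filtration product (fun n => HA n `*` HB n).
Proof. exact: filtered_na. Qed.

Lemma product_class (z : bool) :
  (z -> forall n, pure (HA n)) -> (z -> forall n, pure (HB n)) -> na_class z product.
Proof.
move=> pA pB; exists (fun n => HA n `*` HB n); split; first exact: product_na.
move=> zT n x k k0 [xA xB]; split.
  by apply: (pA zT n _ k k0); rewrite -(raddfMn fst).
by apply: (pB zT n _ k k0); rewrite -(raddfMn snd).
Qed.

Definition product_in : chom A product.
Proof.
apply: (@base0_chom A product HA _ (fun a => (a, 0) : A * B) _ fA.2 product_na.2).
  by move=> x y; congr (_, _); rewrite subrr.
by move=> n; exists n => x Hx; split=> //=; exact: subgroup0 (cf_sub fB.1 n).
Defined.

Definition product_out : chom product B.
Proof.
apply: (@base0_chom product B _ HB (fun x : A * B => x.2) _ product_na.2 fB.2) => //.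
by move=> n; exists n => x [].
Defined.

Definition product_chom (X : topologicalZmodType) (HX : nat -> set X)
    (fX : na_filtration HX) (f : chom A X) (g : chom B X) : chom product X.
Proof.
apply: (@base0_chom product X _ HX (fun x : A * B => f x.1 + g x.2) _ product_na.2 fX.2).
  by move=> [x1 x2] [y1 y2] /=; rewrite !chomB; zmod.
move=> n; have [i Hi] := chom_base0 f fA.2 fX.2 n.
have [j Hj] := chom_base0 g fB.2 fX.2 n; exists (maxn i j) => x [xA xB].
apply: (subgroupD (cf_sub fX.1 n)).
  by apply: Hi; exact: (cf_le fA.1 (leq_maxl i j)).
by apply: Hj; exact: (cf_le fB.1 (leq_maxr i j)).
Defined.

Lemma product_short_exact : short_exact product_in product_out.
Proof.
split.
- by apply: (chom_closed_embedding fA product_na) => n; exists n => a [].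
- by apply/seteqP; split=> [_ [a _ <-]|[a b] /= b0] //; exists a => //; rewrite -b0.
- by apply/seteqP; split=> // b _; exists (0, b).
Qed.
End Product.

Section Discrete.
Variables (G : zmodType) (eG : exists g : nat -> G, forall x, exists k, x = g k).

Definition discrete_group : topologicalZmodType :=
  filtered (discrete_complete_filtration eG).

Lemma discrete_group_na : @na_filtration discrete_group (@discrete_filtration G).
Proof. exact: filtered_na. Qed.

Lemma discrete_group_class z :
  (forall (x : G) n, (0 < n)%N -> x *+ n = 0 -> x = 0) -> na_class z discrete_group.
Proof.
move=> tG; exists (@discrete_filtration G); split; first exact: discrete_group_na.
by move=> _ [|n] //; exact: torsion_free_pure.
Qed.

Lemma discrete_chom (B : topologicalZmodType) (HB : nat -> set B) (f : G -> B) :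
  na_filtration HB -> zmod_morphism f -> exists h : chom discrete_group B, forall x, h x = f x.
Proof.
move=> fB fM.
have cont n : exists m, forall x : discrete_group, discrete_filtration m x -> HB n (f x).
  exists 1%N => _ ->; rewrite -(subrr 0) fM subrr; exact: subgroup0 (cf_sub fB.1 n).
by exists (base0_chom (fM : zmod_morphism (f : discrete_group -> B))
  discrete_group_na.2 fB.2 cont).
Qed.
End Discrete.

(** * A non-split extension *)


Definition poly_int : topologicalZmodType :=
  discrete_group (countable_enum (0 : {poly int})).

Definition poly_int_na : @na_filtration poly_int (@discrete_filtration {poly int}) :=
  discrete_group_na (countable_enum (0 : {poly int})).

Lemma poly_int_class z : na_class z poly_int.
Proof. exact: discrete_group_class poly_int_torsion_free. Qed.

Section LocalizationSequence.
Variable n : nat.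

(** Multiplication by 1 - nX. *)
Let mul (f : {poly int}) : {poly int} := f - (f * 'X) *+ n.

Let mulB (f g : {poly int}) : mul (f - g) = mul f - mul g.
Proof. by rewrite /mul; ring. Qed.

Let coef_mul f k : (mul f)`_k = f`_k - (if k is k'.+1 then f`_k' *+ n else 0).
Proof. by rewrite coefB coefMn coefMX; case: k => [|k] //=; rewrite mul0rn. Qed.

Let mul_inj f : mul f = 0 -> f = 0.
Proof.
move=> /polyP f0; apply/polyP => k; rewrite coef0; elim: k => [|k IH].
  by have := f0 0%N; rewrite coef_mul coef0 subr0.
by have := f0 k.+1; rewrite coef_mul IH mul0rn subr0 coef0.
Qed.

(** By induction on the degree, k divides every coefficient of g; the quotient of g by k is the
    polynomial sought. *)
Let mul_pure f g k : (0 < k)%N -> f *+ k = mul g -> exists g', f = mul g'.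
Proof.
move=> k0 fg; have kZ : (k%:Z : int) != 0 by rewrite eqz_nat -lt0n.
have dvdg i : (k %| g`_i)%Z.
  elim: i => [|i IH].
    have := congr1 (fun p : {poly int} => p`_0) fg; rewrite coefMn coef_mul subr0 => <-.
    by rewrite -mulr_natr natz dvdz_mull.
  have /esym/eqP := congr1 (fun p : {poly int} => p`_i.+1) fg.
  rewrite coefMn coef_mul subr_eq => /eqP ->.
  by apply: rpredD; [rewrite -mulr_natr natz dvdz_mull|exact: rpredMn].
exists (\poly_(i < size g) (g`_i %/ k)%Z); apply: (mulfI (x := k%:R)).
  by rewrite -polyC_natr polyC_eq0 pnatr_eq0 -lt0n.
rewrite mulr_natl fg.
have gE : g = k%:R * \poly_(i < size g) (g`_i %/ k)%Z.
  apply/polyP => i; rewrite mulr_natl coefMn coef_poly; case: ltnP => gi.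
    by rewrite -mulr_natr natz divzK.
  by rewrite nth_default// mul0rn.
by rewrite {1}gE /mul mulrBr mulrnAr mulrA.
Qed.

Lemma localization_sequence : exists (i : chom poly_int poly_int)
    (C : topologicalZmodType) (p : chom poly_int C),
  [/\ forall z, na_class z C, short_exact i p
    & forall f : {poly int}, i f = f - (f * 'X) *+ n :> {poly int}].
Proof.
have [i iE] := discrete_chom (countable_enum (0 : {poly int})) poly_int_na mulB.
have ci : closed_embedding i.
  apply: (chom_closed_embedding poly_int_na poly_int_na) => -[|m]; exists 1%N => f //.
  by rewrite iE => /mul_inj ->.
have sr : subgroup (range i) by apply: subgroup_image; split.
have Nr : [set` zmod_of_subgroup sr] = range i := set_zmod_of_subgroup sr.
exists i, (tquot (zmod_of_subgroup sr)), (chom_pi (zmod_of_subgroup sr)); split.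
- move=> z; exists (fun n => \pi_(tquot (zmod_of_subgroup sr)) @` discrete_filtration n).
  split=> [|_ [|m] y k k0].
  + by apply: quotient_filtration poly_int_na _; rewrite Nr; exact: ci.1.
  + by move=> _; have [x <-] := pi_tquot_surj y; exists x.
  + have [x <-] := pi_tquot_surj y.
    rewrite -pi_tquotMn => /in_pi_image [_ -> ]; rewrite subr0.
    move=> /in_zmod_of_subgroup [g _ gx]; apply/in_pi_image; exists 0 => //.
    rewrite subr0; apply/in_zmod_of_subgroup; move/esym: gx; rewrite iE => gx.
    by have [g' ->] := mul_pure k0 gx; exists g' => //; rewrite iE.
- by apply: tquot_short_exact => //; rewrite Nr.
- exact: iE.
Qed.
End LocalizationSequence.

(** * The exact categories *)

Section ExactClass.
Variables (z : bool) (K : topologicalZmodType -> Prop).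
Hypothesis KP : forall G, K G <-> na_class z G.

Let class_obj (G : topologicalZmodType) (zG : na_class z G) : obj K :=
  Obj ((KP G).2 zG).

Lemma obj_filtration (A : obj K) : exists H : nat -> set A,
  na_filtration H /\ (z -> forall n, pure (H n)).
Proof. exact: (KP A).1 (objP A). Qed.

Let short_exact_factor (A B C : obj K) (i : chom A B) (p : chom B C)
    (X : topologicalZmodType) (HX : nat -> set X) (h : chom B X) :
    short_exact i p -> base0 HX -> (forall a, h (i a) = 0) ->
  exists k : chom C X, forall x, h x = k (p x).
Proof.
move=> ex bX hi; have [HB [fB _]] := obj_filtration B.
have [HC [fC _]] := obj_filtration C.
have [|k kE] := chom_factor fB fC (short_exact_surj ex) (f := h) bX.
  by move=> x /(short_exact_ker ex) [a <-].
by exists k => x; rewrite kE.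
Qed.

(** Left exactness of Hom holds for every [I], the factorization through [p] being given by the open
    mapping theorem; extending morphisms is what remains. *)
Lemma injective_of_extend (I : obj K) :
    (forall (A B : obj K) (i : chom A B) (h : chom A I), closed_embedding i ->
      exists k : chom B I, forall x, k (i x) = h x) ->
  injective_obj I.
Proof.
move=> ext A B C i p ex; have [HI [fI _]] := obj_filtration I; split.
- move=> h hp y; have [x <-] := short_exact_surj ex y; exact: hp.
- move=> h; split=> [hi|[k hk] x]; first exact: short_exact_factor ex fI.2 hi.
  by rewrite hk (short_exact_comp ex) chom0.
- by move=> h; apply: ext; case: ex.
Qed.

Lemma projective_of_lift (P : obj K) :
    (forall (B C : obj K) (p : chom B C) (h : chom P C), (forall y, exists x, p x = y) ->
      exists k : chom P B, forall x, p (k x) = h x) ->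
  projective_obj P.
Proof.
move=> lift A B C i p ex; have [ci _ _] := ex; split.
- move=> h hi x; apply: (closed_embedding_inj ci).
  by rewrite hi chom0.
- move=> h; split=> [ph|[k hk] x]; last by rewrite hk (short_exact_comp ex).
  have [|k kE] := chom_lift (h := h) ci; last by exists k.
  by move=> x; have [a <-] := (short_exact_ker ex _).1 (ph x); exists a.
- move=> h; exact: lift (short_exact_surj ex).
Qed.

Lemma divisible_injective (I : obj K) (HI : nat -> set I) :
  na_filtration HI -> (forall n, divisible (HI n)) -> injective_obj I.
Proof.
move=> fI dI; apply: injective_of_extend => A B i h ci.
have [HA [fA _]] := obj_filtration A; have [HB [fB _]] := obj_filtration B.
exact: divisible_extend h fA fB fI dI ci.
Qed.

Let int_seq_obj := class_obj (int_seq_class z).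

Lemma int_seq_projective : projective_obj int_seq_obj.
Proof.
apply: projective_of_lift => B C p h p_surj.
have [HB [fB _]] := obj_filtration B; have [HC [fC _]] := obj_filtration C.
exact: (int_seq_lift fB fC p_surj).
Qed.

Lemma int_seq_presentation (A : obj K) :
  exists (L : obj K) (e : chom L int_seq_obj) (s : chom int_seq_obj A), short_exact e s.
Proof.
have [HA [fA _]] := obj_filtration A.
have [HP [fP pP]] := obj_filtration int_seq_obj.
have [s s_surj] := int_seq_surjection fA.
have sN : subgroup (s @^-1` [set 0]).
  by apply: subgroup_preim; split=> // x y -> ->; rewrite /set1 /mkset subrr.
have clN : closed [set` zmod_of_subgroup sN].
  rewrite set_zmod_of_subgroup; apply/(base0_closedP fP.2 _ (cf_sub fP.1)) => x Hx.
  apply: (cf_sep fA.1) => n; have [m Hm] := chom_base0 s fP.2 fA.2 n.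
  by have [a a0 /Hm] := Hx m; rewrite chomB a0 subr0.
exists (class_obj (closed_subgroup_class fP clN pP)), (chom_incl fP clN), s; split.
- exact: chom_incl_closed_embedding.
- by rewrite range_chom_incl set_zmod_of_subgroup.
- by apply/seteqP; split=> // y _; have [x <-] := s_surj y; exists x.
Qed.

Lemma class_enough_projectives : enough_projectives K.
Proof.
move=> A; have [L [e [s ex]]] := int_seq_presentation A.
exists int_seq_obj, s; split; first exact: int_seq_projective.
by exists L, e.
Qed.

(** The one-element group ['rV[int]_0] provides the zero object. *)
Let zero_enum : exists g : nat -> 'rV[int]_0, forall x, exists k, x = g k.
Proof. by exists (fun=> 0) => x; exists 0%N; exact: rV0_eq. Qed.

Let zero_obj : obj K :=
  class_obj (discrete_group_class zero_enum z (fun x n _ _ => rV0_eq x 0)).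

Let zero_objP (x y : zero_obj) : x = y.
Proof. exact: rV0_eq. Qed.

Let zero_short_exact (A : obj K) : short_exact (chom_id A) (chom_zero A zero_obj).
Proof.
have [HA [fA _]] := obj_filtration A; split.
- by apply: (chom_closed_embedding fA fA) => n; exists n.
- by apply/seteqP; split=> x _ //; exists x.
- by apply/seteqP; split=> // y _; exists 0.
Qed.

Lemma injective_resolution_self (A : obj K) :
  injective_obj A -> has_injective_resolution A.
Proof.
move=> injA; pose I (n : nat) := if n is 0%N then A else zero_obj.
exists I, (chom_id A), (fun n => chom_zero (I n) (I n.+1)); split.
  case=> [//|n]; apply: injective_of_extend => B C i h _.
  by exists (chom_zero C zero_obj) => x; exact: zero_objP.
exists (fun=> zero_obj), (fun n => chom_zero (I n) zero_obj), (fun=> chom_id zero_obj).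
by split=> [|n|//]; exact: zero_short_exact.
Qed.

Let product_obj (A B : obj K) : exists (X : obj K) (i : chom A X) (p : chom X B)
    (r : X -> A), [/\ short_exact i p, zmod_morphism r, forall a, r (i a) = a
    & forall (Y : obj K) (f : chom A Y) (g : chom B Y),
      exists h : chom X Y, (forall a, h (i a) = f a) /\ forall x, h x = f (r x) + g (p x)].
Proof.
have [HA [fA pA]] := obj_filtration A; have [HB [fB pB]] := obj_filtration B.
exists (class_obj (product_class fA fB pA pB)), (product_in fA fB), (product_out fA fB).
exists (fun x => x.1); split=> //; first exact: product_short_exact.
move=> Y f g; have [HY [fY _]] := obj_filtration Y.
exists (product_chom fA fB fY f g); split=> [a|x] //.
by rewrite -[LHS]/(f a + g 0) chom0 addr0.
Qed.
(* The extension [B -> B * L -> L] spliced with [L -> int_seq -> A] maps to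
   every 2-extension of [A], since [L] and [int_seq] are projective. *)
Lemma versal_extension m (A B : obj K) : exists E0 : yoneda m.+1 A B,
  forall (B' : obj K) (b : chom B B') (E : yoneda m.+1 A B'), yoneda_map b E0 E.
Proof.
elim: m B => [|m IH] B.
  have [L [e [s exs]]] := int_seq_presentation A.
  have [X [i [p [r [exX rB ri XP]]]]] := product_obj B L.
  exists (existT _ L (Extension exX, Extension exs)) => B' b.
  move=> [Z [[M u v exM] [M' u' v' exM']]] /=.
  have [HL [fL _]] := obj_filtration L; have [HM [fM _]] := obj_filtration M.
  have [HZ [fZ _]] := obj_filtration Z.
  (* [s] lifts to [q], whose restriction to [L] lands in [Z] as [t]; this lifts further to [M]
     because [L] is a closed subgroup of [int_seq]. *)
  have [_ _ /(_ s) [q qE]] := int_seq_projective exM'.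
  have [ci' _ _] := exM'; have [ce _ _] := exs.
  have [|t tE] := chom_lift (h := chom_comp q e) ci'.
    move=> x; have [y yE] := (short_exact_ker exM' (q (e x))).1
      (etrans (qE _) (short_exact_comp exs x)).
    by exists y.
  have fP := int_seq_na.
  have [t' t'E] := subgroup_int_seq_lift t fL fM fZ ce (short_exact_surj exM).
  have [f [fi fE]] := XP M (chom_comp u b) t'.
  exists f, t; split=> //.
    by move=> x; rewrite fE chomD (short_exact_comp exM) add0r t'E.
  by exists q; split=> // x; rewrite tE.
(* In higher degrees the sequence is padded on the left with [B -> B -> 0]. *)
have [E0 E0P] := IH zero_obj.
exists (existT _ zero_obj (Extension (zero_short_exact B), E0)) => B' b [Z [[M u v exM] E]] /=.
exists (chom_comp u b), (chom_zero zero_obj Z); split=> //.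
  by move=> x; exact: (short_exact_comp exM).
exact: E0P.
Qed.

(** Any two extensions of length at least 2 receive a map from the same versal one. *)
Lemma class_Ext_vanishes : Ext_vanishes_above K 1.
Proof.
move=> [//|m] _ A B E E'; have [E0 E0P] := versal_extension m A B.
by apply: (@yoneda_equiv_trans _ _ _ _ _ E0);
  [apply: yoneda_equiv_sym|]; apply: yoneda_equiv_map.
Qed.

(** Splitting of the underlying abstract groups, an invariant of Yoneda equivalence that tells the
    localization sequence from the trivial extension. *)
Let retract (A B : obj K) (E : extension A B) : Prop :=
  exists2 r : ext_mid E -> B, zmod_morphism r & forall b, r (ext_in E b) = b.

(** By the five lemma the middle map is bijective, so retractions can be carried both ways. *)
Let retract_map (A B : obj K) (E E' : extension A B) :
  @yoneda_map K 0 A B B (chom_id B) E E' -> retract E <-> retract E'.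
Proof.
case: E E' => [M i p ex] [M' i' p' ex'] [f [fi fp]] /=.
split=> [[r rB ri]|[r rB ri]]; rewrite /= in r rB ri fi fp *; last first.
  exists (fun x => r (f x)) => [x y|b]; first by rewrite chomB rB.
  by rewrite fi ri.
have f_inj x : f x = 0 -> x = 0.
  move=> fx; have px : p x = 0 by rewrite -fp fx chom0.
  have [b bx] := (short_exact_ker ex x).1 px.
  have [ci' _ _] := ex'; rewrite -bx (_ : b = 0) ?chom0//.
  by apply: (closed_embedding_inj ci'); rewrite chom0 -[b]/(chom_id B b) -fi bx.
have /choice [g gK] y : exists x, f x = y.
  have [x xy] := short_exact_surj ex (p' y).
  have py : p' (y - f x) = 0 by rewrite chomB fp xy subrr.
  have [b bE] := (short_exact_ker ex' _).1 py.
  by exists (x + i b); rewrite chomD fi bE; zmod.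
have fK x : g (f x) = x.
  by apply/eqP; rewrite -subr_eq0; apply/eqP/f_inj; rewrite chomB gK subrr.
exists (fun y => r (g y)) => [y y'|b].
  rewrite -rB; congr r; apply/eqP; rewrite -subr_eq0; apply/eqP/f_inj.
  by rewrite !chomB !gK subrr.
by rewrite -[b in i' b]/(chom_id B b) -fi fK ri.
Qed.

Let retract_equiv (A B : obj K) (E E' : yoneda 0 A B) :
  yoneda_equiv E E' -> retract E <-> retract E'.
Proof.
elim=> {E E'} [E E' /retract_map //|E|E E' _ IH|E E' E'' _ IH1 _ IH2] //.
  by split=> /IH.
by split=> [/IH1/IH2|/IH2/IH1].
Qed.

Let poly_int_obj : obj K := class_obj (poly_int_class z).

Lemma class_Ext_nonvanishing : ~ Ext_vanishes_above K 0.
Proof.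
move=> /(_ 0%N isT) van.
have [i [C [p [zC ex iE]]]] := localization_sequence 2.
have [X [i' [p' [r' [exX rB' ri' _]]]]] := product_obj poly_int_obj (class_obj (zC z)).
pose E := @Extension K (class_obj (zC z)) poly_int_obj poly_int_obj i p ex.
have [_ /(_ _)] := retract_equiv (van _ _ E (Extension exX)).
case; first by exists r'.
move=> /= r rB ri.
pose r_mixin := GRing.isZmodMorphism.Build {poly int} {poly int} r rB.
pose s : {additive {poly int} -> {poly int}} := HB.pack r r_mixin.
pose x (k : nat) : {poly int} := 'X^k.
have sE k : s (x k) = x k + s (x k.+1) *+ 2.
  have := ri (x k); rewrite iE -[r _]/(s _) raddfB raddfMn -exprSr => xk.
  by rewrite -[X in X + _]xk subrK.
have sE' k : s (x 0%N) = \sum_(j < k) x j *+ 2 ^ j + s (x k) *+ 2 ^ k.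
  elim: k => [|k ->]; first by rewrite big_ord0 add0r.
  by rewrite sE big_ord_recr /= mulrnDl addrA -mulrnA -expnS.
(* In degree N the polynomial [s (x 0)] has coefficient 0, while the right-hand side gives [2 ^ N]
   times an odd integer. *)
pose N := size (s (x 0%N)).
have := congr1 (fun f : {poly int} => f`_N) (sE' N.+1).
rewrite nth_default// coefD coef_sum big_ord_recr /= big1 => [|j _]; last first.
  by rewrite coefMn coefXn gtn_eqF// mul0rn.
rewrite add0r !coefMn coefXn eqxx /=.
set c := _`_N; rewrite expnS mulrnA -mulrnDl => /esym/eqP.
rewrite mulrn_eq0 expn_eq0 /= => /eqP; lia.
Qed.
End ExactClass.

(* If extensions along [f |-> (1 - n X) f] exist, any sequence [a] is of the form
   [a_k = b_k - n b_(k+1)], so [b_0 = a_0 + n a_1 + ... + n^k a_k] modulo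
   [n^(k+1)]. When [d] is not divisible by [n] modulo [H j], choosing the [a_k] in
   [{0, d}] diagonally keeps [b_0] out of all the countably many cosets of [H j]. *)
Lemma extension_divisible (I : topologicalZmodType) (H : nat -> set I) (n : nat)
    (i : chom poly_int poly_int) : na_filtration H -> (forall j, pure (H j)) ->
    (0 < n)%N -> (forall f : {poly int}, i f = f - (f * 'X) *+ n :> {poly int}) ->
    (forall h : chom poly_int I, exists k : chom poly_int I, forall f, k (i f) = h f) ->
  forall x : I, exists y, y *+ n = x.
Proof.
move=> fI pH n0 iE ext; have [cI bI] := fI; have sI := cf_sub cI.
have mod_div j d : exists y, H j (d - y *+ n).
  apply: contrapT => nd; have [g gH] := cf_countable cI j.
  (* The k-th state is the partial sum of the [a_i n^i] for i < k; the next one avoids the coset of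
     [g k] modulo [n^(k+1)]. *)
  pose S k (s s' : I) := exists a, s' = s + a *+ n ^ k /\
    forall y, ~ H j (g k - s' - y *+ n ^ k.+1).
  have [//|k s _|u [u0 _ Su]] := @dependent_choice_from I (fun _ _ => True) S 0.
    have [Ha|] := pselect (forall y, ~ H j (g k - s - y *+ n ^ k.+1)).
      by exists s => //; exists 0; split=> //; rewrite mul0rn addr0.
    (* If both 0 and [d] failed as values of [a_k], then [n^k d] would be divisible by [n^(k+1)]
       modulo [H j]; purity cancels [n^k] and contradicts the choice of [d]. *)
    move=> /existsNP [y /contrapT Hy]; exists (s + d *+ n ^ k) => //.
    exists d; split=> // y' Hy'; apply: nd; exists (y - y').
    apply: (pH j _ (n ^ k)%N); first by rewrite expn_gt0 n0.
    have -> : (d - (y - y') *+ n) *+ n ^ k =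
        d *+ n ^ k - (y *+ n ^ k.+1 - y' *+ n ^ k.+1).
      by rewrite !mulrnBl -!mulrnA -expnS.
    by have := subgroupB (sI j) Hy Hy'; congr (H j _); zmod.
  have [a aE] := choice Su.
  have [h hE] := discrete_chom (countable_enum (0 : {poly int})) fI (poly_homB a).
  have [b bE] := ext h.
  pose X (k : nat) : {poly int} := 'X^k.
  have bS k : b (X k) = a k + b (X k.+1) *+ n.
    have := bE (X k); rewrite hE poly_homXn iE => <-.
    by rewrite -exprSr chomB chomMn subrK.
  have bu k : b (X 0%N) = u k + b (X k) *+ n ^ k.
    elim: k => [|k IH]; first by rewrite u0 add0r.
    by rewrite IH bS mulrnDl -mulrnA -expnS (aE k).1 addrA.
  have [k bk] := gH (b (X 0%N)).
  apply: ((aE k).2 (b (X k.+1))); rewrite -addrA -opprD -bu.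
  exact: (subgroup_subC (sI j)).
have subBB (u v w : I) : u - v = (w - v) - (w - u) by zmod.
(* By purity, n-th roots of x modulo successive levels are congruent, so they converge to a true
   root. *)
move=> x; have [y Hy] := choice (mod_div^~ x).
have [|l Hl] := cf_complete cI (x := y).
  move=> j; apply: (pH j _ n n0).
  rewrite mulrnBl (subBB _ _ x).
  exact: (subgroupB (sI j) (Hy j) (cf_S cI (Hy j.+1))).
exists l; apply/esym/(na_filtration_eq fI) => j.
have -> : x - l *+ n = (x - y j *+ n) - (l *+ n - y j *+ n) by zmod.
rewrite -mulrnBl.
by apply: (subgroupB (sI j)) => //; exact: (subgroupMn (sI j)).
Qed.

(** * Injectivity and divisibility in type Z *)

Section TypeZ.
Variable K : topologicalZmodType -> Prop.
Hypothesis KP : forall G, K G <-> na_class true G.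

Let divisible_obj (A : obj K) : Prop :=
  forall (x : A) n, (0 < n)%N -> exists y, y *+ n = x.

Lemma injective_obj_divisible (I : obj K) : injective_obj I -> divisible_obj I.
Proof.
move=> inj x n n0; have [H [fI pI]] := obj_filtration KP I.
have [i [C [p [zC ex iE]]]] := localization_sequence n.
pose P := Obj ((KP _).2 (poly_int_class true)).
have [_ _ ext] := @inj P P (Obj ((KP _).2 (zC true))) i p ex.
exact: (extension_divisible fI (pI isT) n0 iE ext).
Qed.

Lemma divisible_obj_injective (A : obj K) : divisible_obj A -> injective_obj A.
Proof.
move=> dA; have [H [fA pA]] := obj_filtration KP A.
apply: (divisible_injective KP fA) => n x k k0 Hx.
have [y yx] := dA x k k0; exists y => //.
by apply: (pA isT n y k k0); rewrite yx.
Qed.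

(** A root in [B] of an element of [A] maps to a torsion element of [C], which is 0 because the
    levels of [C] are pure; so the root lies in [A]. *)
Lemma short_exact_divisible (A B C : obj K) (i : chom A B) (p : chom B C) :
  short_exact i p -> divisible_obj B -> divisible_obj A.
Proof.
move=> ex dB x n n0; have [y yx] := dB (i x) n n0.
have [HC [fC pC]] := obj_filtration KP C.
have py : p y = 0.
  apply: (cf_sep fC.1) => j; apply: (pC isT j _ n n0).
  rewrite -chomMn yx (short_exact_comp ex); exact: subgroup0 (cf_sub fC.1 j).
have [a ay] := (short_exact_ker ex y).1 py; exists a.
have [ci _ _] := ex; apply: (closed_embedding_inj ci).
by rewrite chomMn ay yx.
Qed.

(** An injective object containing Z[X] with quotient of type Z would make Z[X] divisible, but 1 is
    not twice a polynomial. *)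
Lemma type_Z_not_enough_injectives : ~ enough_injectives K.
Proof.
pose P := Obj ((KP _).2 (poly_int_class true)).
move=> /(_ P) [I [i [/injective_obj_divisible dI [C [p ex]]]]].
have [y] := short_exact_divisible ex dI (1 : {poly int}) (ltn0Sn 1).
move=> /(congr1 (fun f : {poly int} => f`_0)); rewrite coefMn coef1 eqxx /=; lia.
Qed.

Lemma type_Z_injective_resolution (A : obj K) :
  has_injective_resolution A <-> injective_obj A.
Proof.
split=> [[I [eta [d [injI [Z [p [j [ex _ _]]]]]]]]|injA].
  (* The first short exact sequence of the resolution makes [A] the kernel of a map from a divisible
     object to one of type Z. *)
  apply: divisible_obj_injective; apply: short_exact_divisible ex _.
  exact: injective_obj_divisible.
exact: (injective_resolution_self KP).
Qed.
End TypeZ.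

(** * The two categories of the theorem *)

Lemma PAb_nA_class (R : realType) (G : topologicalZmodType) :
  PAb_nA R G <-> na_class false G.
Proof.
rewrite PAb_nAP; split=> [[H fH]|[H [fH _]]]; last by exists H.
by exists H; split.
Qed.

Lemma proLiePAb_Z_class (R : realType) (G : topologicalZmodType) :
  proLiePAb_Z R G <-> na_class true G.
Proof.
rewrite proLiePAb_ZP; split=> [[H [fH pH]]|[H [fH /(_ isT) pH]]]; last by exists H.
by exists H; split=> // _.
Qed.

Lemma class_homological_dimension (z : bool) (K : topologicalZmodType -> Prop) :
  (forall G, K G <-> na_class z G) -> homological_dimension K 1.
Proof.
move=> KP; split; first exact: class_Ext_vanishes KP.
by case=> // /(class_Ext_nonvanishing KP).
Qed.

(** Every closed embedding is an admissible monic here, since quotients by closed subgroups stay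
    non-Archimedean Polish; in type Z purity may be lost in the quotient. *)
Lemma PAb_nA_enough_injectives (R : realType) : enough_injectives (PAb_nA R).
Proof.
have KP := @PAb_nA_class R.
move=> A; have [HA [fA _]] := obj_filtration KP A.
have [I [HI [j [fI dI cj]]]] := divisible_embedding fA.
have zI : PAb_nA R I by apply/KP; exists HI; split.
exists (Obj zI), j; split; first exact: (divisible_injective KP (I := Obj zI) fI dI).
have sr : subgroup (range j) by apply: subgroup_image; split.
have Nr : [set` zmod_of_subgroup sr] = range j := set_zmod_of_subgroup sr.
have zQ : PAb_nA R (tquot (zmod_of_subgroup sr)).
  apply/KP; eexists; split; last by [].
  by apply: quotient_filtration fI _; rewrite Nr; exact: cj.1.
by exists (Obj zQ), (chom_pi (zmod_of_subgroup sr)); exact: tquot_short_exact.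
Qed.

Theorem corollary4p17 (R : realType) :
  [/\ enough_injectives (PAb_nA R),
      enough_projectives (PAb_nA R)
    & homological_dimension (PAb_nA R) 1] /\
  [/\ enough_projectives (proLiePAb_Z R),
      ~ enough_injectives (proLiePAb_Z R),
      homological_dimension (proLiePAb_Z R) 1
    & forall A : obj (proLiePAb_Z R),
        has_injective_resolution A <-> injective_obj A].
Proof.
have KA := @PAb_nA_class R; have KZ := @proLiePAb_Z_class R.
split; split.
- exact: PAb_nA_enough_injectives.
- exact: class_enough_projectives KA.
- exact: class_homological_dimension KA.
- exact: class_enough_projectives KZ.
- exact: type_Z_not_enough_injectives KZ.
- exact: class_homological_dimension KZ.
- exact: type_Z_injective_resolution KZ.
Qed.
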